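(* Let $\alpha>0$ and $c>0$. There exists a probability law $\mu_{\alpha,c}$ depending only on $\alpha$ and $c$ such that the following holds. Let $m=m(n)$ be positive integers with $m/n\to\alpha$ as $n\to+\infty$. For $n\geq c$, let $A_n$ be a random $n\times m$ matrix with i.i.d. entries of Bernoulli law of parameter $c/n$ (value $1$ with probability $c/n$, value $0$ with probability $1-c/n$), and let $W_n'=\frac1c A_nA_n^T$. Then, almost surely, $\mu_{W_n'}$ converges weakly to $\mu_{\alpha,c}$ as $n\to+\infty$. Hence, if $X_n$ is a random $n\times m$ matrix with i.i.d. entries of centered Bernoulli law $P_n$ given by $P_n(-\tfrac cn)=1-\tfrac cn$ and $P_n(1-\tfrac cn)=\tfrac cn$, and $W_n=\frac1c X_nX_n^T$, then, almost surely, $\mu_{W_n}$ converges weakly to $\mu_{\alpha,c}$.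
   Context: For a real symmetric $n\times n$ matrix $W$, $\mu_W=\frac1n\sum_{\lambda\in\mathrm{Spec}(W)}\delta_\lambda$ (eigenvalues counted with multiplicity) is its spectral measure. All random matrices, for all $n$, are defined on a common probability space. *)

(* Defs.v *)
From HB Require Import structures.
From mathcomp Require Import all_boot all_order all_algebra.
From mathcomp Require Import polyrcf.
From mathcomp Require Import all_classical all_reals all_analysis.
Set Implicit Arguments.
Unset Strict Implicit.
Unset Printing Implicit Defensive.
Import Order.TTheory GRing.Theory Num.Theory.
Import numFieldNormedType.Exports.
Local Open Scope classical_set_scope.
Local Open Scope ring_scope.

Section spectrum.
Context {R : realType} (n : nat) (W : 'M[R]_n).

(* Each real eigenvalue is repeated according to its multiplicity as a root of
   the characteristic polynomial; for symmetric W the list has length n. *)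
Definition spectrum : seq R :=
  flatten [seq nseq (mup x (char_poly W)) x | x <- rootsR (char_poly W)].

Lemma count_spectrum x : count_mem x spectrum = mup x (char_poly W).
Proof.
have p0 : char_poly W != 0 by rewrite monic_neq0 // char_poly_monic.
have sumE (s : seq R) : uniq s ->
    count_mem x (flatten [seq nseq (mup y (char_poly W)) y | y <- s])
    = if x \in s then mup x (char_poly W) else 0%N.
  elim: s => [//|y s IHs] /= /andP[ys us].
  rewrite count_cat count_nseq IHs // in_cons /= (eq_sym y).
  have [->|_] /= := eqVneq x y; last by rewrite mul0n add0n.
  by rewrite (negbTE ys) mul1n addn0.
rewrite sumE; last exact: uniq_roots.
have rootE : (x \in rootsR (char_poly W)) = root (char_poly W) x.
  by rewrite (roots_onP (roots_on_rootsR p0)) // in_itv.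
by rewrite rootE; case: ifPn => // /mupNroot ->.
Qed.

Lemma mem_spectrum x : (x \in spectrum) = eigenvalue W x.
Proof.
have p0 : char_poly W != 0 by rewrite monic_neq0 // char_poly_monic.
rewrite eigenvalue_root_char root_factor_theorem XsubC_dvd //.
by rewrite -count_spectrum -has_count has_pred1.
Qed.

Definition spectral_measure : {measure set R -> \bar R} :=
  mscale (n%:R^-1)%:nng
    (msum (fun k => \d_(spectrum`_k)) (size spectrum)).

End spectrum.

Definition weak_cvg {R : realType} (mu_ : nat -> {measure set R -> \bar R})
    (mu : {measure set R -> \bar R}) : Prop :=
  forall f : R -> R, continuous f -> bounded_fun f ->
    (\int[mu_ n]_x (f x)%:E)%E @[n --> \oo] --> (\int[mu]_x (f x)%:E)%E.

Section random_matrices.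
Context d (T : measurableType d) (R : realType) (P : probability T R).

Definition mutually_independent (I : finType) (X : I -> {RV P >-> R}) : Prop :=
  forall (J : {set I}) (B : I -> set R), (forall i, measurable (B i)) ->
    P (\bigcap_(i in [set` J]) X i @^-1` B i)
    = (\prod_(i in J) P (X i @^-1` B i))%E.

Definition two_point_law (p a b : R) (X : {RV P >-> R}) : Prop :=
  forall B : set R, measurable B ->
    distribution P X B = ((1 - p)%:E * \d_a B + p%:E * \d_b B)%E.

Definition iid_two_point_entries (n m : nat) (p a b : R)
    (X : 'I_n -> 'I_m -> {RV P >-> R}) : Prop :=
  mutually_independent (fun ij : 'I_n * 'I_m => X ij.1 ij.2) /\
  forall i j, two_point_law p a b (X i j).

Definition sample_mx (n m : nat) (X : 'I_n -> 'I_m -> {RV P >-> R}) (w : T)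
  : 'M[R]_(n, m) := \matrix_(i, j) X i j w.

End random_matrices.

Definition scaled_gram {R : realType} (c : R) (n m : nat) (A : 'M[R]_(n, m))
  : 'M[R]_n := c^-1 *: (A *m A^T).

(* Main.v *)
(** Expected traces of powers of [A A^T] count closed walks on the complete
    bipartite graph: a walk with [e] distinct edges has weight [(c/n)^e].
    Grouping walks by their kernel (which positions carry equal vertices), only
    the kernels whose graph is a tree survive as [n] grows, so the moments of the
    mean spectral measure converge to numbers [M_k] depending on [alpha] and [c]
    only, with [M_k <= C^k (2k)!].

    This growth makes the moment problem on the half-line determinate.  Writing
    [sigma = sqrt x], the functions [sigma^i cos^(i) (s sigma)] can be
    approximated by polynomials in [x] up to a polynomial error of arbitrarily
    small [M]-mass: for [s = 0] they are polynomials, and a Taylor expansion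
    carries the property from [s] to [s + h] when [4 C h^2 <= 1/2].  Polynomials
    in [cos (theta sigma)] then reach all bounded continuous functions.  Hence
    the mean spectral measures converge weakly, and the limit functional is
    integration against the Stieltjes measure of its distribution function.

    For almost sure convergence, a rank-one positive perturbation changes
    [tr (1 + W)^-j] by at most [j].  Replacing one column of [A] thus changes it
    by at most [2j], and a fourth moment martingale estimate gives deviation
    probabilities [O(n^-2)], so that Borel-Cantelli applies whatever the joint
    law of the matrices for different [n].  Centering the entries also amounts to
    two rank-one perturbations, and convergence of the integrals of [(1 + x)^-j]
    for all [j] implies weak convergence. *)

Require Import Defs.
From HB Require Import structures.
From mathcomp Require Import all_boot all_order all_algebra.
From mathcomp Require Import spectral complex.
From mathcomp Require Import all_classical all_reals all_analysis.
From mathcomp Require Import measurable_realfun.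
From mathcomp Require Import ring lra zify.
Set Implicit Arguments.
Unset Strict Implicit.
Unset Printing Implicit Defensive.
Import Order.TTheory GRing.Theory Num.Theory.
Import numFieldNormedType.Exports.
Local Open Scope classical_set_scope.
Local Open Scope ring_scope.

(** * Resolvents under rank-one perturbations *)

(** Moments are sensitive to one large column, whereas a rank-one change of any size moves
    [\tr ((1 + W) ^- j)] by a bounded amount. Hence moments are only computed in expectation, and
    resolvent traces carry the almost sure statement. The independent units are the columns: [m]
    martingale increments of size [O(1/n)]. Their variance is only [O(1/n)], which is not summable;
    the fourth moment is of order [m^2 n^-4].

    The factorial [(2k)!] comes from counting pairs of kernels crudely by [k^k k^k]. It suits the
    half-line: with [x = sigma^2], a Taylor remainder of order [2k] in [sigma] carries the factor
    [1/(2k)!], which absorbs the growth of the mass of [x^k].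

    No measure with moments [M_k] is available at first, so errors are weighed by the formal
    functional sending [x^k] to [M_k]. The measure comes later, from a limit of positive
    functionals. The powers [(1 + x)^-j] are monotone, so they can be integrated from the
    distribution function alone, by slicing into layers. *)

Section resolvent.
Context {R : realFieldType} {n : nat}.
Implicit Types (W M : 'M[R]_n) (x y v : 'cV[R]_n).

Definition dot x y : R := (x^T *m y) 0 0.

Lemma dotC x y : dot x y = dot y x.
Proof. by rewrite /dot -[in LHS](trmxK y) -trmx_mul mxE. Qed.

Lemma dotE x y : dot x y = \sum_i x i 0 * y i 0.
Proof. by rewrite /dot mxE; apply: eq_bigr => i _; rewrite mxE. Qed.

Lemma dot_ge0 x : 0 <= dot x x.
Proof. by rewrite dotE sumr_ge0// => i _; rewrite -expr2 sqr_ge0. Qed.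

Lemma dot_eq0 x : (dot x x == 0) = (x == 0).
Proof.
apply/eqP/eqP => [|->]; last by rewrite dotE big1// => i _; rewrite mxE mul0r.
rewrite dotE => /eqP; rewrite psumr_eq0 => [|i _]; last by rewrite -expr2 sqr_ge0.
move=> /allP x0; apply/colP => i; rewrite mxE; apply/eqP.
by have := x0 i (mem_index_enum _); rewrite mulf_eq0 orbb.
Qed.

Lemma dotDr x y z : dot x (y + z) = dot x y + dot x z.
Proof. by rewrite /dot mulmxDr mxE. Qed.

Lemma dotDl x y z : dot (x + y) z = dot x z + dot y z.
Proof. by rewrite dotC dotDr !(dotC z). Qed.

Lemma dotZr k x y : dot x (k *: y) = k * dot x y.
Proof. by rewrite /dot -scalemxAr mxE. Qed.

Lemma dotZl k x y : dot (k *: x) y = k * dot x y.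
Proof. by rewrite dotC dotZr dotC. Qed.

(** Expanding the squares of [x + y] and [x - y] gives [2 |<x, y>| <= <x, x> + <y, y>]; this weak
    Cauchy-Schwarz inequality avoids square roots. *)
Lemma dot_le_max x y r : dot x x <= r -> dot y y <= r -> `|dot x y| <= r.
Proof.
move=> xr yr; have := dot_ge0 (x + y); have := dot_ge0 (x + (-1) *: y).
rewrite !dotDr !dotDl !dotZr !dotZl (dotC y x) => h1 h2.
by rewrite ler_norml; apply/andP; split; lra.
Qed.

Definition psd W := W^T = W /\ forall x, 0 <= dot x (W *m x).

Lemma psdD W M : psd W -> psd M -> psd (W + M).
Proof.
move=> [sW pW] [sM pM]; split => [|x]; first by rewrite linearD/= sW sM.
by rewrite mulmxDl dotDr addr_ge0.
Qed.

Lemma psd_rank1 b v : 0 <= b -> psd (b *: (v *m v^T)).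
Proof.
move=> b0; split => [|x]; first by rewrite linearZ/= trmx_mul trmxK.
rewrite -scalemxAl dotZr mulr_ge0// -mulmxA.
have -> : v^T *m x = (dot v x)%:M by rewrite [LHS]mx11_scalar.
by rewrite mul_mx_scalar dotZr (dotC x) -expr2 sqr_ge0.
Qed.

(** The resolvent at the point [-1], which lies off the half-line containing the spectrum of a
    positive semidefinite [W], so everything stays real. *)
Definition resolvent W := invmx (1%:M + W).

Lemma unitmx_psd W : psd W -> 1%:M + W \in unitmx.
Proof.
move=> [sW pW]; rewrite -row_free_unit; apply: inj_row_free => u uW.
apply: trmx_inj; rewrite trmx0; apply/eqP; rewrite -dot_eq0 eq_le dot_ge0 andbT.
have : dot u^T ((1%:M + W) *m u^T) = 0.
  rewrite -[1%:M + W]trmxK -trmx_mul linearD/= sW trmx1 uW trmx0.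
  by rewrite /dot mulmx0 mxE.
rewrite mulmxDl mul1mx dotDr => h; have := pW u^T; lra.
Qed.

Lemma resolvent_mulV W x : psd W -> (1%:M + W) *m (resolvent W *m x) = x.
Proof. by move=> pW; rewrite mulmxA mulmxV ?mul1mx// unitmx_psd. Qed.

Lemma resolvent_sym W : psd W -> (resolvent W)^T = resolvent W.
Proof. by move=> [sW _]; rewrite /resolvent trmx_inv linearD/= trmx1 sW. Qed.

(** With [y = G x], expanding [x = y + W y] gives [<x, x> = <y, y> + 2 <y, W y> + <W y, W y>]. *)
Lemma resolvent_contraction W x : psd W ->
  dot (resolvent W *m x) (resolvent W *m x) <= dot x x.
Proof.
move=> pW; set y := resolvent W *m x.
rewrite -[in leRHS](resolvent_mulV x pW) -/y mulmxDl mul1mx.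
rewrite !dotDr !dotDl (dotC (W *m y) y).
have := pW.2 y; have := dot_ge0 (W *m y); lra.
Qed.

Lemma resolventX_contraction W k x : psd W ->
  dot (resolvent W ^+ k *m x) (resolvent W ^+ k *m x) <= dot x x.
Proof.
move=> pW; elim: k => [|k IH]; first by rewrite expr0 mul1mx.
rewrite exprS -mulmxA; apply: le_trans (resolvent_contraction _ pW) IH.
Qed.

Lemma resolvent_energy W v : psd W ->
  dot (resolvent W *m v) (resolvent W *m v) <= dot v (resolvent W *m v).
Proof.
move=> pW; set y := resolvent W *m v.
rewrite -[in leRHS](resolvent_mulV v pW) -/y mulmxDl mul1mx dotDl.
by rewrite (dotC (W *m y)) lerDl pW.2.
Qed.

Section rank_one.
Context (W : 'M[R]_n) (b : R) (v : 'cV[R]_n) (pW : psd W) (b0 : 0 <= b).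
Let W' := W + b *: (v *m v^T).
Let G := resolvent W.
Let G' := resolvent W'.
Let a := dot v (G *m v).

Let pW' : psd W'. Proof. by apply: psdD => //; exact: psd_rank1. Qed.

Let a_ge0 : 0 <= a.
Proof. exact: le_trans (dot_ge0 _) (resolvent_energy v pW). Qed.

(* Sherman-Morrison *)
Lemma resolvent_rank1_vec : G' *m v = (1 + b * a)^-1 *: (G *m v).
Proof.
have ba : 1 + b * a != 0 by rewrite gt_eqF// ltr_pwDl// mulr_ge0.
apply: (can_inj (mulKmx (unitmx_psd pW'))).
rewrite resolvent_mulV// -scalemxAr /W' addrA mulmxDl resolvent_mulV//.
rewrite -scalemxAl -mulmxA.
have -> : v^T *m (G *m v) = a%:M by rewrite [LHS]mx11_scalar.
rewrite mul_mx_scalar scalerA -{2}[v]scale1r -scalerDl scalerA mulVf//.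
by rewrite scale1r.
Qed.

Lemma resolvent_rank1_sub : G - G' = b *: (G' *m (v *m v^T) *m G).
Proof.
have uW := unitmx_psd pW; have uW' := unitmx_psd pW'.
rewrite scalemxAl scalemxAr.
have -> : b *: (v *m v^T) = (1%:M + W') - (1%:M + W) by rewrite /W' addrA [RHS]addrC addKr.
rewrite mulmxBr mulmxBl mulVmx// mul1mx -mulmxA.
by rewrite (mulmxV uW) mulmx1.
Qed.

(** By Sherman-Morrison the trace is [b / (1 + b a)] times an inner product of two contractions of
    [u = G v]. Since [<u, u> <= a], it is at most [b a / (1 + b a) <= 1], uniformly in [b], [v] and
    [n]. *)
Lemma trace_rank1_step k l : `|\tr (G' ^+ k *m (G - G') *m G ^+ l)| <= 1.
Proof.
set u := G *m v.
have -> : \tr (G' ^+ k *m (G - G') *m G ^+ l) =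
    b * (1 + b * a)^-1 * dot (G ^+ l *m u) (G' ^+ k *m u).
  have sX : (G ^+ l)^T = G ^+ l.
    elim: l => [|l IH]; first by rewrite !expr0 trmx1.
    by rewrite exprS trmx_mul IH resolvent_sym// -[RHS]exprS exprSr.
  rewrite resolvent_rank1_sub -scalemxAr -scalemxAl mxtraceZ -mulrA; congr (_ * _).
  have -> : G' ^+ k *m (G' *m (v *m v^T) *m G) *m G ^+ l =
      (G' ^+ k *m (G' *m v)) *m (v^T *m (G *m G ^+ l)) by rewrite !mulmxA.
  rewrite mxtrace_mulC resolvent_rank1_vec -dotZr [in RHS]scalemxAr /dot trmx_mul sX.
  by rewrite trmx_mul resolvent_sym// /mxtrace big_ord1 !mulmxA.
have ba : 0 < 1 + b * a by rewrite ltr_pwDl// mulr_ge0.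
have ua : dot u u <= a by exact: resolvent_energy.
rewrite normrM ger0_norm; last by rewrite mulr_ge0// invr_ge0 ltW.
rewrite mulrAC ler_pdivrMr// mul1r.
apply: (@le_trans _ _ (b * a)); last by rewrite lerDr.
rewrite ler_wpM2l//; apply: dot_le_max; apply: le_trans ua;
  exact: resolventX_contraction.
Qed.

(** Telescoping: each of the [k] replacements of a factor [G] by [G'] costs at most 1. The trailing
    [G ^+ l] collects the factors split off by the induction. *)
Lemma trace_rank1_diff k l :
  `|\tr ((G ^+ k - G' ^+ k) *m G ^+ l)| <= k%:R.
Proof.
elim: k l => [|k IH] l; first by rewrite subrr mul0mx mxtrace0 normr0.
have -> : G ^+ k.+1 - G' ^+ k.+1 = (G ^+ k - G' ^+ k) *m G + G' ^+ k *m (G - G').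
  by rewrite mulmxBl mulmxBr !exprSr addrA subrK.
have GS : (G ^+ k - G' ^+ k) *m G *m G ^+ l = (G ^+ k - G' ^+ k) *m G ^+ l.+1.
  by rewrite exprS mulmxA.
rewrite mulmxDl mxtraceD GS -natr1 (le_trans (ler_normD _ _))//.
by apply: lerD; [exact: IH|exact: trace_rank1_step].
Qed.

Lemma trace_resolvent_rank1 k : `|\tr (G ^+ k) - \tr (G' ^+ k)| <= k%:R.
Proof. by have := trace_rank1_diff k 0; rewrite expr0 mulmx1 linearB. Qed.

End rank_one.

(** The rank-one bound only covers positive perturbations, so two matrices are compared through a
    common upper bound [W] instead of through their indefinite difference. *)
Lemma trace_resolvent_rank2 W W1 W2 b v1 v2 k : psd W1 -> psd W2 -> 0 <= b ->
  W = W1 + b *: (v1 *m v1^T) -> W = W2 + b *: (v2 *m v2^T) ->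
  `|\tr (resolvent W1 ^+ k) - \tr (resolvent W2 ^+ k)| <= 2 * k%:R.
Proof.
move=> p1 p2 b0 e1 e2.
have h1 := trace_resolvent_rank1 v1 p1 b0 k; rewrite -e1 in h1.
have h2 := trace_resolvent_rank1 v2 p2 b0 k; rewrite -e2 distrC in h2.
apply: le_trans (ler_distD (\tr (resolvent W ^+ k)) _ _) _.
by rewrite mulr_natl mulr2n lerD.
Qed.

End resolvent.

(** * Column replacement and centering of Gram matrices *)

Section gram.
Context {R : realFieldType} {n m : nat} (c : R) (c0 : 0 <= c).
Implicit Types A B : 'M[R]_(n, m).

Definition gram A : 'M[R]_n := c *: (A *m A^T).

Lemma psd_gram A : psd (gram A).
Proof.
split => [|x]; first by rewrite linearZ/= trmx_mul trmxK.
rewrite -scalemxAl dotZr mulr_ge0// -mulmxA.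
rewrite /dot mulmxA (_ : x^T *m A = (A^T *m x)^T); first exact: dot_ge0.
by rewrite trmx_mul trmxK.
Qed.

Lemma gram_col_split (j : 'I_m) A :
  gram A = gram (\matrix_(i, k) (if k == j then 0 else A i k))
           + c *: (col j A *m (col j A)^T).
Proof.
rewrite /gram -scalerDr; congr (_ *: _); apply/matrixP => i i'; rewrite !mxE.
rewrite (bigD1 j)//= big_ord1 !mxE addrC; congr (_ + _).
rewrite [RHS](bigD1 j)//= !mxE eqxx mul0r add0r.
by apply: eq_bigr => k /negPf kj; rewrite !mxE kj.
Qed.

(** Erasing column [j] turns [A] and [B] into the same matrix, of which both Gram matrices are
    positive rank-one perturbations. *)
Lemma trace_gram_col (j : 'I_m) A B k :
  (forall i l, l != j -> A i l = B i l) ->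
  `|\tr (resolvent (gram A) ^+ k) - \tr (resolvent (gram B) ^+ k)| <= 2 * k%:R.
Proof.
move=> AB; pose Z := gram (\matrix_(i, k) (if k == j then 0 else A i k)).
have ZB : Z = gram (\matrix_(i, k) (if k == j then 0 else B i k)).
  congr gram; apply/matrixP => i l; rewrite !mxE; case: eqP => // /eqP; exact: AB.
have pZ : psd Z by exact: psd_gram.
have hA := trace_resolvent_rank1 (col j A) pZ c0 k; rewrite -gram_col_split in hA.
have hB := trace_resolvent_rank1 (col j B) pZ c0 k.
rewrite {2}ZB -gram_col_split distrC in hB.
rewrite distrC; apply: le_trans (ler_distD (\tr (resolvent Z ^+ k)) _ _) _.
by rewrite distrC addrC distrC mulr_natl mulr2n lerD// distrC.
Qed.

(* With [J] the all-ones matrix and [t = p A 1 - (p^2 m / 2) 1],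
   [(A - p J)(A - p J)^T + (1 + t)(1 + t)^T / 2 = A A^T + (1 - t)(1 - t)^T / 2]. *)
Lemma trace_gram_shift A p k :
  `|\tr (resolvent (gram (A - const_mx p)) ^+ k)
    - \tr (resolvent (gram A) ^+ k)| <= 2 * k%:R.
Proof.
pose t : 'cV[R]_n := \col_i (p * (\sum_j A i j) - p ^+ 2 * m%:R / 2).
pose w : 'cV[R]_n := const_mx 1 + t.
pose z : 'cV[R]_n := const_mx 1 - t.
apply: (@trace_resolvent_rank2 _ _ (gram (A - const_mx p) + (c / 2) *: (w *m w^T))
  _ _ (c / 2) w z) => //; [exact: psd_gram|exact: psd_gram|by rewrite divr_ge0|].
rewrite /gram -!scalerA -!scalerDr; congr (_ *: _).
apply/matrixP => i i'; rewrite !mxE !big_ord1 !mxE.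
under eq_bigr do rewrite !mxE mulrBl !mulrBr.
rewrite !sumrB sumr_const card_ord -mulr_suml -mulr_sumr.
under [in RHS]eq_bigr do rewrite !mxE.
set S := \sum_(i < m) _ * _; rewrite -mulr_natl.
by field.
Qed.

End gram.

(** * The spectral theorem for real symmetric matrices *)

Lemma conj_mxX (F : fieldType) n (P X : 'M[F]_n) k : P \in unitmx ->
  (invmx P *m X *m P) ^+ k = invmx P *m X ^+ k *m P.
Proof.
move=> uP; elim: k => [|k IH]; first by rewrite !expr0 mulmx1 mulVmx.
by rewrite !exprS IH -[LHS]/(_ *m _) !mulmxA mulmxK.
Qed.

Lemma diag_mxX (F : fieldType) n (d : 'rV[F]_n) k :
  diag_mx d ^+ k = diag_mx (map_mx (fun x => x ^+ k) d).
Proof.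
elim: k => [|k IH].
  rewrite expr0; apply/matrixP => i j; rewrite !mxE expr0; by case: eqP.
rewrite exprS IH -[LHS]/(_ *m _) mulmx_diag; congr diag_mx.
by apply/rowP => i; rewrite !mxE exprS.
Qed.

Lemma invmx_uniq (F : fieldType) n (X Y : 'M[F]_n) : X *m Y = 1%:M -> invmx X = Y.
Proof.
move=> XY; have [uX _] := mulmx1_unit XY.
by rewrite -[RHS]mul1mx -(mulVmx uX) -mulmxA XY mulmx1.
Qed.

Lemma invmx_diag (F : fieldType) n (d : 'rV[F]_n) : (forall i, d 0 i != 0) ->
  invmx (diag_mx d) = diag_mx (map_mx (fun x => x^-1) d).
Proof.
move=> d0; apply: invmx_uniq; rewrite mulmx_diag.
by apply/matrixP => i j; rewrite !mxE; case: eqP => // _; rewrite mulfV.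
Qed.

Lemma char_poly_conj (F : fieldType) n (P X : 'M[F]_n) : P \in unitmx ->
  char_poly (invmx P *m X *m P) = char_poly X.
Proof.
move=> uP; pose Q := map_mx polyC P; pose Q' := map_mx polyC (invmx P).
have QQ : Q' *m Q = 1%:M by rewrite -map_mxM mulVmx// map_mx1.
rewrite /char_poly.
have -> : char_poly_mx (invmx P *m X *m P) = Q' *m char_poly_mx X *m Q.
  rewrite /char_poly_mx mulmxBr mulmxBl !map_mxM.
  by rewrite -/Q -/Q' [Q' *m 'X%:M]scalar_mxC -(mulmxA 'X%:M) QQ mulmx1.
by rewrite !det_mulmx mulrAC -det_mulmx QQ det1 mul1r.
Qed.

Section real_spectrum.
Context {R : realType} {n : nat} (W : 'M[R]_n) (W_sym : W^T = W).

Let toC : {rmorphism R -> R[i]} := real_complex R.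
Let P := spectralmx (map_mx toC W).

(** The complexification of a symmetric real matrix is hermitian, hence unitarily diagonalizable
    with real diagonal: taking real parts loses nothing. *)
Definition eigenvalues : 'rV[R]_n := \row_i complex.Re (spectral_diag (map_mx toC W) 0 i).

Let D := diag_mx (map_mx toC eigenvalues).

Lemma complex_diagonalization : map_mx toC W = invmx P *m D *m P.
Proof.
have WC_herm : map_mx toC W \is hermsymmx.
  apply: realsym_hermsym.
    by apply/is_hermitianmxP; rewrite expr0 scale1r map_mx_id// map_trmx W_sym.
  by apply/mxOverP => i j; rewrite mxE /= complex_real eqxx.
have /orthomx_spectralP WE := hermitian_normalmx WC_herm.
rewrite [LHS]WE; congr (_ *m diag_mx _ *m _).
have /mxOverP dR := hermitian_spectral_diag_real WC_herm.
apply/rowP => i; rewrite !mxE.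
by apply/esym/RRe_real; exact: dR.
Qed.

Let uP : P \in unitmx. Proof. exact: spectral_unit. Qed.

Lemma trace_conj_diag (d : 'rV[R[i]]_n) : \tr (invmx P *m diag_mx d *m P) = \sum_i d 0 i.
Proof. by rewrite mxtrace_mulC mulmxA mulmxV// mul1mx mxtrace_diag. Qed.

Lemma char_poly_eigenvalues :
  char_poly W = \prod_i ('X - (eigenvalues 0 i)%:P).
Proof.
apply: (map_poly_inj toC); rewrite map_char_poly complex_diagonalization.
rewrite char_poly_conj// char_poly_trig; last exact: diag_mx_is_trig.
rewrite rmorph_prod; apply: eq_bigr => i _.
by rewrite rmorphB/= map_polyX map_polyC/= !mxE eqxx.
Qed.

Lemma trace_powers k : \tr (W ^+ k) = \sum_i eigenvalues 0 i ^+ k.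
Proof.
apply: (fmorph_inj toC); rewrite -trace_map_mx.
have -> : map_mx toC (W ^+ k) = map_mx toC W ^+ k.
  elim: k => [|k IH]; first by rewrite !expr0 map_mx1.
  by rewrite !exprS -IH; exact: map_mxM.
rewrite complex_diagonalization conj_mxX// diag_mxX trace_conj_diag rmorph_sum.
by apply: eq_bigr => i _; rewrite !mxE rmorphXn.
Qed.

Context (W_psd : psd W).

Lemma eigenvalues_ge0 i : 0 <= eigenvalues 0 i.
Proof.
have : eigenvalue W (eigenvalues 0 i).
  rewrite eigenvalue_root_char char_poly_eigenvalues (bigD1 i)//=.
  by rewrite rootM root_XsubC eqxx.
move=> /eigenvalueP[v vW v0].
have := W_psd.2 v^T; rewrite -{1}W_sym -trmx_mul vW linearZ/= dotZr.
rewrite pmulr_lge0// lt_def dot_ge0 dot_eq0 andbT.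
by apply: contra v0 => /eqP vT; rewrite -[v]trmxK vT trmx0.
Qed.

Lemma trace_resolvent_powers k :
  \tr (resolvent W ^+ k) = \sum_i (1 + eigenvalues 0 i) ^- k.
Proof.
apply: (fmorph_inj toC); rewrite -trace_map_mx.
have -> : map_mx toC (resolvent W ^+ k) = map_mx toC (resolvent W) ^+ k.
  elim: k => [|k IH]; first by rewrite !expr0 map_mx1.
  by rewrite !exprS -IH; exact: map_mxM.
have E i : 1 + eigenvalues 0 i != 0 by rewrite gt_eqF// ltr_wpDr ?eigenvalues_ge0.
have -> : map_mx toC (resolvent W) =
    invmx P *m diag_mx (map_mx toC (map_mx (fun x => (1 + x)^-1) eigenvalues)) *m P.
  have -> : map_mx (fun x => toC x) (map_mx (fun x => (1 + x)^-1) eigenvalues) =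
      map_mx (fun x => x^-1) (map_mx toC (map_mx (fun x => 1 + x) eigenvalues)).
    by apply/rowP => i; rewrite !mxE fmorphV.
  rewrite -invmx_diag; last by move=> i; have := E i; rewrite !mxE fmorph_eq0.
  rewrite /resolvent map_invmx map_mxD map_mx1 complex_diagonalization.
  set E1 := diag_mx _.
  have -> : 1%:M + invmx P *m D *m P = invmx P *m E1 *m P.
    have -> : E1 = 1%:M + D.
      apply/matrixP => i j; rewrite !mxE.
      by case: eqP => _; rewrite ?mulr1n ?mulr0n ?addr0// rmorphD rmorph1.
    by rewrite mulmxDr mulmxDl mulmx1 mulVmx.
  have uE1 : E1 \in unitmx.
    rewrite unitmxE det_diag unitfE; apply/prodf_neq0 => i _.
    by have := E i; rewrite !mxE fmorph_eq0.
  apply: invmx_uniq; rewrite !mulmxA (mulmxK uP).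
  by rewrite -(mulmxA (invmx P)) mulmxV// mulmx1 mulVmx.
rewrite conj_mxX// diag_mxX trace_conj_diag rmorph_sum.
by apply: eq_bigr => i _; rewrite !mxE -exprVn rmorphXn.
Qed.

(** Both lists repeat each [x] as often as its multiplicity in the characteristic polynomial, which
    is the product of the ['X - (eigenvalues 0 i)%:P]. *)
Lemma perm_spectrum : perm_eq (spectrum W) [seq eigenvalues 0 i | i <- enum 'I_n].
Proof.
apply/allP => x _ /=; rewrite count_spectrum char_poly_eigenvalues.
rewrite -big_enum /= -(big_map (fun i => eigenvalues 0 i) xpredT (fun x => 'X - x%:P)).
elim: [seq _ | i <- _] => [|y s IH] /=.
  by rewrite big_nil; apply/eqP/mupNroot; rewrite root1.
rewrite big_cons mupM ?polyXsubC_eq0 ?monic_neq0 ?monic_prod_XsubC ?monicXsubC//.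
rewrite (eqP IH) -(expr1 ('X - _)) mup_XsubCX eq_sym.
by case: eqP.
Qed.

Lemma sum_spectrum (f : R -> R) :
  \sum_(x <- spectrum W) f x = \sum_i f (eigenvalues 0 i).
Proof. by rewrite (perm_big _ perm_spectrum) big_map big_enum. Qed.

End real_spectrum.

(** * Concentration on finite product spaces *)

Section product_expectation.
Context {R : realFieldType} {I V : finType} (q : V -> R).
Context (q_ge0 : forall v, 0 <= q v) (q_sum1 : \sum_v q v = 1).

Definition prodE (F : {ffun I -> V} -> R) : R :=
  \sum_(a : {ffun I -> V}) (\prod_i q (a i)) * F a.

Definition upd (a : {ffun I -> V}) i v : {ffun I -> V} :=
  [ffun k => if k == i then v else a k].

Lemma prod_weight_ge0 (a : {ffun I -> V}) : 0 <= \prod_i q (a i).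
Proof. exact: prodr_ge0. Qed.

Lemma prodE1 : prodE (fun=> 1) = 1.
Proof.
rewrite /prodE; under eq_bigr do rewrite mulr1.
rewrite -(bigA_distr_bigA (fun (_ : I) v => q v)).
by rewrite big1.
Qed.

Lemma eq_prodE F G : (forall a, F a = G a) -> prodE F = prodE G.
Proof. by move=> FG; apply: eq_bigr => a _; rewrite FG. Qed.

Lemma prodED F G : prodE (fun a => F a + G a) = prodE F + prodE G.
Proof. by rewrite -big_split; apply: eq_bigr => a _; rewrite mulrDr. Qed.

Lemma prodEZ k F : prodE (fun a => k * F a) = k * prodE F.
Proof. by rewrite mulr_sumr; apply: eq_bigr => a _; rewrite mulrCA. Qed.

Lemma prodE_cst k : prodE (fun=> k) = k.
Proof. by rewrite -[RHS]mulr1 -prodE1 -prodEZ; apply: eq_prodE => a; rewrite mulr1. Qed.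

Lemma le_prodE F G : (forall a, F a <= G a) -> prodE F <= prodE G.
Proof.
by move=> FG; apply: ler_sum => a _; rewrite ler_wpM2l ?prod_weight_ge0.
Qed.

Lemma prodE_sum (J : finType) (F : J -> {ffun I -> V} -> R) :
  prodE (fun a => \sum_j F j a) = \sum_j prodE (F j).
Proof.
by rewrite [RHS]exchange_big; apply: eq_bigr => a _; rewrite mulr_sumr.
Qed.

(** Resampling one coordinate preserves the product law: exchanging [a i] with the fresh value [v]
    is a weight-preserving involution. *)
Lemma prodE_avg (i : I) F :
  prodE (fun a => \sum_v q v * F (upd a i v)) = prodE F.
Proof.
pose h (x : {ffun I -> V} * V) := (upd x.1 i x.2, x.1 i).
have hK : involutive h.
  move=> [a v]; congr pair => /=; last by rewrite ffunE eqxx.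
  by apply/ffunP => k; rewrite !ffunE; case: eqP => [->|].
have wE a v : (\prod_k q (upd a i v k)) * q (a i) = (\prod_k q (a k)) * q v.
  rewrite (bigD1 i) //= [in RHS](bigD1 i) //= ffunE eqxx.
  rewrite (eq_bigr (fun k => q (a k))); first by ring.
  by move=> k /negPf ki; rewrite ffunE ki.
rewrite /prodE.
under eq_bigr do rewrite mulr_sumr.
rewrite pair_big /= (reindex_inj (inv_inj hK)) /=.
rewrite -(pair_bigA _ (fun a v => (\prod_k q (upd a i v k)) *
   (q (a i) * F (upd (upd a i v) i (a i))))) /=.
apply: eq_bigr => a _.
under eq_bigr => v _.
  rewrite mulrA wE (_ : upd (upd a i v) i (a i) = a); last first.
    by apply/ffunP => k; rewrite !ffunE; case: eqP => [->|].
  rewrite -mulrA mulrCA.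
  over.
by rewrite -big_distrl /= q_sum1 mul1r.
Qed.

Definition bounded_difference (d : R) (F : {ffun I -> V} -> R) :=
  forall a i v, `|F (upd a i v) - F a| <= d.

Lemma avgl (f : V -> R) k : \sum_v q v * (k * f v) = k * \sum_v q v * f v.
Proof. by rewrite mulr_sumr; apply: eq_bigr => v _; rewrite mulrCA. Qed.

Lemma avg_cst k : \sum_v q v * k = k.
Proof. by rewrite -big_distrl /= q_sum1 mul1r. Qed.

Lemma avgD (f g : V -> R) :
  \sum_v q v * (f v + g v) = \sum_v q v * f v + \sum_v q v * g v.
Proof. by rewrite -big_split; apply: eq_bigr => v _; rewrite mulrDr. Qed.

Lemma le_avg (f g : V -> R) :
  (forall v, f v <= g v) -> \sum_v q v * f v <= \sum_v q v * g v.
Proof. by move=> fg; apply: ler_sum => v _; rewrite ler_wpM2l. Qed.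

(** The term linear in [y] is kept because it averages to zero in a martingale step. From
    [2 t y^3 <= t^2 y^2 + y^4], the cubic term raises the coefficients 6 and 1 to 8 and 3. *)
Lemma fourth_power_step (t y d : R) : `|y| <= d ->
  (t + y) ^+ 4 <= t ^+ 4 + 4 * t ^+ 3 * y + (8 * d ^+ 2 * t ^+ 2 + 3 * d ^+ 4).
Proof.
move=> yd.
have y2 : y ^+ 2 <= d ^+ 2.
  by rewrite -[y ^+ 2]real_normK ?num_real// lerXn2r ?nnegrE// (le_trans _ yd).
have y4 : y ^+ 4 <= d ^+ 4.
  by rewrite !(exprM _ 2 2) lerXn2r ?nnegrE ?sqr_ge0.
have h1 : t ^+ 2 * y ^+ 2 <= t ^+ 2 * d ^+ 2 by rewrite ler_wpM2l ?sqr_ge0.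
have h2 : 0 <= (t * y - y ^+ 2) ^+ 2 by exact: sqr_ge0.
have h3 : (t * y - y ^+ 2) ^+ 2 = t ^+ 2 * y ^+ 2 - 2 * (t * y ^+ 3) + y ^+ 4 by ring.
have -> : (t + y) ^+ 4 = t ^+ 4 + 4 * t ^+ 3 * y + 6 * (t ^+ 2 * y ^+ 2)
   + 4 * (t * y ^+ 3) + y ^+ 4 by ring.
by lra.
Qed.

Lemma second_moment_step (t y d : R) : `|y| <= d ->
  (t + y) ^+ 2 <= t ^+ 2 + 2 * t * y + d ^+ 2.
Proof.
move=> yd.
have y2 : y ^+ 2 <= d ^+ 2.
  by rewrite -[y ^+ 2]real_normK ?num_real// lerXn2r ?nnegrE// (le_trans _ yd).
have -> : (t + y) ^+ 2 = t ^+ 2 + 2 * t * y + y ^+ 2 by ring.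
by lra.
Qed.

(** Doob martingale, by induction on a list [J] of coordinates on which [F] depends. Averaging out
    one coordinate gives [G] with the same mean and the same difference bound, and [F - G] is an
    increment of conditional mean zero. The second moment is carried along because the fourth-moment
    step uses it. *)
Lemma prodE_moments_bounded_difference (J : seq I) (d : R) F : 0 <= d ->
  bounded_difference d F ->
  (forall a b : {ffun I -> V}, (forall i, i \in J -> a i = b i) -> F a = F b) ->
  let s := (size J)%:R in
  prodE (fun a => (F a - prodE F) ^+ 2) <= s * d ^+ 2 /\
  prodE (fun a => (F a - prodE F) ^+ 4) <= 4 * s ^+ 2 * d ^+ 4.
Proof.
move=> d0; elim: J F => [|i J IH] F bF dF /=.
  have F_cst a : prodE F = F a.
    by rewrite -[RHS]prodE_cst; apply: eq_prodE => b; exact: dF.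
  by split; under eq_prodE => a do rewrite (F_cst a) subrr expr0n /=;
     rewrite prodE_cst ?mul0r// expr0n mulr0 mul0r.
pose G a := \sum_v q v * F (upd a i v).
have EG : prodE G = prodE F by exact: prodE_avg.
have updK a v w : upd (upd a i v) i w = upd a i w.
  by apply/ffunP => k; rewrite !ffunE; case: eqP.
have FG a v : `|F (upd a i v) - G a| <= d.
  rewrite -[F _](avg_cst) /G -sumrB.
  under eq_bigr do rewrite -mulrBr.
  apply: le_trans (ler_norm_sum _ _ _) _.
  rewrite -[leRHS]avg_cst; apply: ler_sum => w _.
  by rewrite normrM ger0_norm// ler_wpM2l// -(updK a w v) bF.
have bG : bounded_difference d G.
  move=> a k v; rewrite /G -sumrB.
  under eq_bigr do rewrite -mulrBr.
  apply: le_trans (ler_norm_sum _ _ _) _.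
  rewrite -[leRHS]avg_cst; apply: ler_sum => w _.
  rewrite normrM ger0_norm// ler_wpM2l//.
  have [->|ki] := eqVneq k i; first by rewrite updK subrr normr0.
  rewrite (_ : upd (upd a k v) i w = upd (upd a i w) k v) ?bF//.
  apply/ffunP => l; rewrite !ffunE; case: (eqVneq l i) => [->|//].
  by rewrite eq_sym (negPf ki).
have dG (a b : {ffun I -> V}) : (forall k, k \in J -> a k = b k) -> G a = G b.
  move=> ab; apply: eq_bigr => v _; congr (_ * _); apply: dF => k.
  rewrite in_cons !ffunE; case: eqP => //= _; exact: ab.
have [] := IH G bG dG; rewrite EG => IH2 IH4.
have Y0 a : \sum_v q v * (F (upd a i v) - G a) = 0.
  under eq_bigr do rewrite mulrBr.
  by rewrite sumrB avg_cst subrr.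
have s1 : (size J).+1%:R = (size J)%:R + 1 :> R by rewrite -natr1.
set s := (size J)%:R in IH2 IH4 s1.
split.
  rewrite -(prodE_avg i).
  apply: (@le_trans _ _ (prodE (fun a => (G a - prodE F) ^+ 2 + d ^+ 2))).
    apply: le_prodE => a.
    apply: (@le_trans _ _ (\sum_v q v * (((G a - prodE F) ^+ 2 + d ^+ 2) +
       2 * (G a - prodE F) * (F (upd a i v) - G a)))).
      apply: le_avg => v; rewrite [leRHS]addrAC.
      rewrite (_ : F (upd a i v) - prodE F =
        (G a - prodE F) + (F (upd a i v) - G a)); last by ring.
      exact: second_moment_step.
    by rewrite avgD avg_cst avgl Y0 mulr0 addr0.
  rewrite prodED prodE_cst s1 mulrDl mul1r; lra.
rewrite -(prodE_avg i).
apply: (@le_trans _ _ (prodE (fun a => (G a - prodE F) ^+ 4 +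
   (8 * d ^+ 2 * (G a - prodE F) ^+ 2 + 3 * d ^+ 4)))).
  apply: le_prodE => a.
  apply: (@le_trans _ _ (\sum_v q v * (((G a - prodE F) ^+ 4 +
     (8 * d ^+ 2 * (G a - prodE F) ^+ 2 + 3 * d ^+ 4)) +
     4 * (G a - prodE F) ^+ 3 * (F (upd a i v) - G a)))).
    apply: le_avg => v; rewrite [leRHS]addrAC.
      rewrite (_ : F (upd a i v) - prodE F =
        (G a - prodE F) + (F (upd a i v) - G a)); last by ring.
      exact: fourth_power_step.
  by rewrite avgD avg_cst avgl Y0 mulr0 addr0.
rewrite !prodED !prodEZ prodE_cst s1.
(* The induction closes because [4 s^2 + 8 s + 3 <= 4 (s + 1)^2]. *)
have : 8 * d ^+ 2 * prodE (fun a => (G a - prodE F) ^+ 2)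
    <= 8 * d ^+ 2 * (s * d ^+ 2).
  by rewrite ler_wpM2l ?mulr_ge0 ?exprn_ge0.
have -> : 8 * d ^+ 2 * (s * d ^+ 2) = 8 * s * d ^+ 4 by ring.
have -> : 4 * (s + 1) ^+ 2 * d ^+ 4 = 4 * s ^+ 2 * d ^+ 4 + 8 * s * d ^+ 4 + 4 * d ^+ 4 by ring.
have : 0 <= d ^+ 4 by rewrite exprn_ge0.
by lra.
Qed.

Lemma prodE_markov4 (F : {ffun I -> V} -> R) (e : R) : 0 < e ->
  \sum_(a : {ffun I -> V} | e < `|F a|) \prod_i q (a i) <= prodE (fun a => F a ^+ 4) / e ^+ 4.
Proof.
move=> e0; rewrite ler_pdivlMr ?exprn_gt0// mulr_suml big_mkcond /=.
apply: ler_sum => a _; have w0 := prod_weight_ge0 a.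
have F4 : 0 <= F a ^+ 4 by rewrite (exprM _ 2 2) sqr_ge0.
case: ifP => [eF|_]; last by rewrite mulr_ge0.
rewrite ler_wpM2l// -[leRHS]ger0_norm// normrX.
by rewrite lerXn2r ?nnegrE ?(ltW e0)// ltW.
Qed.

Lemma concentration (d e : R) F : 0 <= d -> 0 < e -> bounded_difference d F ->
  \sum_(a : {ffun I -> V} | e < `|F a - prodE F|) \prod_i q (a i)
  <= 4 * #|I|%:R ^+ 2 * d ^+ 4 / e ^+ 4.
Proof.
move=> d0 e0 bF.
apply: le_trans (prodE_markov4 (fun a => F a - prodE F) e0) _.
rewrite ler_wpM2r ?invr_ge0 ?exprn_ge0 ?(ltW e0)// cardE.
have dF (a b : {ffun I -> V}) : (forall i, i \in enum I -> a i = b i) -> F a = F b.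
  by move=> ab; congr F; apply/ffunP => i; rewrite ab ?mem_enum.
by have [] := prodE_moments_bounded_difference d0 bF dF.
Qed.

End product_expectation.

(** * Closed walks and their kernels *)

Section closed_walks.
Context {R : comNzRingType} {n : nat}.

Lemma sum_tuple_cons (T : finType) k (F : k.+1.-tuple T -> R) :
  \sum_t F t = \sum_x \sum_(t : k.-tuple T) F [tuple of x :: t].
Proof.
rewrite pair_big /= (reindex (fun z : T * k.-tuple T => [tuple of z.1 :: z.2])) //=.
exists (fun t : k.+1.-tuple T => (thead t, [tuple of behead t])) => [[x t]|t] _ /=.
  by congr pair; apply: val_inj.
by rewrite [RHS]tuple_eta.
Qed.

Lemma sum_ffun_tuple (T : finType) k (F : {ffun 'I_k -> T} -> R) :
  \sum_u F u = \sum_(t : k.-tuple T) F [ffun s => tnth t s].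
Proof.
rewrite (reindex (fun t : k.-tuple T => [ffun s => tnth t s])) //=.
exists (fun u : {ffun 'I_k -> T} => [tuple u s | s < k]) => [t|u] _.
  by apply: eq_from_tnth => s; rewrite tnth_mktuple ffunE.
by apply/ffunP => s; rewrite ffunE tnth_mktuple.
Qed.

(** [t] lists the interior vertices. Prepending [x] gives the sources of the steps; the default [y]
    of [nth y t s] is reached exactly at [s = k] and is the endpoint. *)
Lemma mxX_walks (W : 'M[R]_n) k x y : (W ^+ k.+1) x y =
  \sum_(t : k.-tuple 'I_n) \prod_(s < k.+1) W (nth x (x :: t) s) (nth y t s).
Proof.
elim: k x => [|k IH] x.
  rewrite expr1 (big_pred1 [tuple]) => [|t]; last by apply/esym/eqP; exact: tuple0.
  by rewrite big_ord1.
rewrite exprS mxE sum_tuple_cons; apply: eq_bigr => z _.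
rewrite IH mulr_sumr; apply: eq_bigr => t _.
rewrite [RHS]big_ord_recl /=; congr (_ * _); apply: eq_bigr => s _ /=.
by congr (W _ _); apply: set_nth_default; rewrite /= size_tuple.
Qed.

Lemma trace_walks (W : 'M[R]_n) k : \tr (W ^+ k.+1) =
  \sum_(u : {ffun 'I_k.+1 -> 'I_n}) \prod_s W (u s) (u (ordS s)).
Proof.
rewrite sum_ffun_tuple sum_tuple_cons; apply: eq_bigr => x _.
rewrite mxX_walks; apply: eq_bigr => t _; apply: eq_bigr => s _.
rewrite !ffunE !(tnth_nth x) /=; congr (W _ _).
have [sk|ks] := ltnP s k; first by rewrite modn_small.
have -> : s = k :> nat by apply/eqP; rewrite eqn_leq ks -ltnS ltn_ord.
by rewrite modnn nth_default// size_tuple.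
Qed.

End closed_walks.

Section walk_graph.
Context {X Y : finType} {k : nat}.
Implicit Types (u : {ffun 'I_k -> X}) (v : {ffun 'I_k -> Y}).

(** The step from row [u s] to row [u (ordS s)] of the walk for [A A^T] passes through column [v s],
    hence two edges per step. *)
Definition walk_edges u v : {set X * Y} :=
  [set (u s, v s) | s : 'I_k] :|: [set (u (ordS s), v s) | s : 'I_k].

End walk_graph.

Section connectivity.
Context {X Y : finType} (u : nat -> X) (v : nat -> Y).

Fixpoint left_vertices l : {set X} :=
  if l is l'.+1 then u l'.+1 |: left_vertices l' else [set u 0].

Fixpoint right_vertices l : {set Y} :=
  if l is l'.+1 then v l' |: right_vertices l' else finset.set0.

Fixpoint prefix_edges l : {set X * Y} :=
  if l is l'.+1 then (u l'.+1, v l') |: ((u l', v l') |: prefix_edges l') else finset.set0.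

Lemma prefix_edges_sub l e : e \in prefix_edges l ->
  (e.1 \in left_vertices l) && (e.2 \in right_vertices l).
Proof.
have ul j : u j \in left_vertices j by case: j => [|j]; rewrite /= ?set11 ?setU11.
elim: l => [|l IH] /=; first by rewrite !inE.
rewrite !inE => /orP[/eqP->|/orP[/eqP->|/IH/andP[-> ->]]] /=; rewrite ?eqxx ?ul ?orbT//.
Qed.

(** Each newly visited vertex is entered by an edge that cannot have been used before, and only the
    starting vertex comes without one. *)
Lemma card_vertices_le_edges l :
  (#|left_vertices l| + #|right_vertices l| <= #|prefix_edges l|.+1)%N.
Proof.
elim: l => [|l IH] /=; first by rewrite cards1 cards0.
rewrite !cardsU1.
set e1 := (_, _) \notin _; set e0 := (_, _) \notin _.
have h0 : (v l \notin right_vertices l <= e0)%N.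
  rewrite /e0; case: (boolP (v l \in _)) => //= vl.
  suff -> : (u l, v l) \notin prefix_edges l by [].
  by apply: contra vl => /prefix_edges_sub/andP[].
have h1 : (u l.+1 \notin left_vertices l <= e1)%N.
  rewrite /e1; case: (boolP (u l.+1 \in _)) => //= ul.
  suff -> : (u l.+1, v l) \notin (u l, v l) |: prefix_edges l by [].
  rewrite !inE negb_or; apply/andP; split.
    apply: contra ul => /eqP[->]; case: (l) => [|j] /=; by rewrite ?set11 ?setU11.
  by apply: contra ul => /prefix_edges_sub/andP[].
move: IH h0 h1; lia.
Qed.

Lemma mem_left_vertices l s : (s <= l)%N -> u s \in left_vertices l.
Proof.
elim: l => [|l IH]; first by rewrite leqn0 => /eqP->; rewrite set11.
by rewrite leq_eqVlt ltnS => /orP[/eqP->|/IH] /=; rewrite !inE ?eqxx// => ->; rewrite orbT.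
Qed.

Lemma mem_right_vertices l s : (s < l)%N -> v s \in right_vertices l.
Proof.
elim: l => [//|l IH].
by rewrite ltnS leq_eqVlt => /orP[/eqP->|/IH] /=; rewrite !inE ?eqxx// => ->; rewrite orbT.
Qed.

End connectivity.

Section kernels.
Context {k : nat}.

(* [pick] only depends on the extension of its predicate, so [ker u] is a
   canonical representative of the partition into level sets of [u]. *)
Definition ker (X : eqType) (u : {ffun 'I_k -> X}) : {ffun 'I_k -> 'I_k} :=
  [ffun s => odflt s [pick t | u t == u s]].

Lemma kerK (X : eqType) (u : {ffun 'I_k -> X}) s : u (ker u s) = u s.
Proof. by rewrite ffunE; case: pickP => [t /eqP|/(_ s)]; rewrite ?eqxx. Qed.

Lemma ker_eq (X : eqType) (u : {ffun 'I_k -> X}) s t :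
  (ker u s == ker u t) = (u s == u t).
Proof.
apply/eqP/eqP => [e|e]; first by rewrite -kerK e kerK.
by rewrite !ffunE e; case: pickP => [//|/(_ t)]; rewrite eqxx.
Qed.

Lemma eq_ker (X Y : eqType) (u : {ffun 'I_k -> X}) (v : {ffun 'I_k -> Y}) :
  (forall s t, (u s == u t) = (v s == v t)) -> ker u = ker v.
Proof.
move=> uv; apply/ffunP => s; rewrite !ffunE; congr odflt; apply: eq_pick => t; exact: uv.
Qed.

Lemma ker_ker (X : eqType) (u : {ffun 'I_k -> X}) : ker (ker u) = ker u.
Proof. by apply: eq_ker => s t; rewrite ker_eq. Qed.

(** A function with kernel [r] amounts to an injection of the set of class representatives, the
    image of [r], into ['I_N]. *)
Lemma card_ker N (r : {ffun 'I_k -> 'I_k}) : ker r = r ->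
  #|[set u : {ffun 'I_k -> 'I_N} | ker u == r]%SET| = (N ^_ #|[set r s | s : 'I_k]|)%N.
Proof.
move=> rr; pose D := [set r s | s : 'I_k].
have rD s : r s \in D by apply/imsetP; exists s.
pose D' : finType := {x | x \in D}.
pose G (f : {ffun D' -> 'I_N}) : {ffun 'I_k -> 'I_N} := [ffun s => f (exist _ (r s) (rD s))].
have -> : [set u : {ffun 'I_k -> 'I_N} | ker u == r]%SET =
    (G @: [set f : {ffun D' -> 'I_N} | injectiveb f])%SET.
  apply/setP => u; rewrite inE; apply/eqP/imsetP => [ur|[f]].
    exists [ffun d : D' => u (val d)].
      rewrite inE; apply/injectiveP => -[d dD] [d' d'D]; rewrite !ffunE /= => udd.
      apply: val_inj => /=; case/imsetP: dD d'D udd => s _ -> /imsetP[t _ ->].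
      by rewrite -ur !kerK => /eqP; rewrite -ker_eq => /eqP.
    by apply/ffunP => s; rewrite !ffunE /= -{1}(kerK u s) ur.
  rewrite inE => /injectiveP fI ->; rewrite -[RHS]rr; apply: eq_ker => s t.
  by rewrite !ffunE (inj_eq fI) -val_eqE.
rewrite card_in_imset; last first.
  move=> f g _ _ /ffunP fg; apply/ffunP => -[d dD].
  case/imsetP: (dD) => s _ ds; have := fg s; rewrite !ffunE.
  by rewrite (_ : exist _ (r s) _ = exist _ d dD)//; apply: val_inj.
by rewrite card_inj_ffuns card_ord card_sig.
Qed.

Lemma card_walk_edges_ker (X Y : finType) (u : {ffun 'I_k -> X}) (v : {ffun 'I_k -> Y}) :
  #|walk_edges u v| = #|walk_edges (ker u) (ker v)|.
Proof.
pose h (e : 'I_k * 'I_k) := (u e.1, v e.2).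
rewrite (_ : walk_edges u v = h @: walk_edges (ker u) (ker v)).
  have edge e : e \in walk_edges (ker u) (ker v) ->
      exists s t, e = (ker u s, ker v t).
    by rewrite inE => /orP[] /imsetP[s _ ->]; [exists s, s|exists (ordS s), s].
  apply: card_in_imset => e e' /edge[s [t ->]] /edge[s' [t' ->]] [].
  rewrite !kerK => /eqP us /eqP vt.
  by congr pair; apply/eqP; rewrite ker_eq.
rewrite finset.imsetU /walk_edges; congr (_ :|: _); rewrite -imset_comp;
  by apply: eq_imset => s; rewrite /h /= !kerK.
Qed.

End kernels.

Lemma walk_graph_connected k (X Y : finType) (u : {ffun 'I_k.+1 -> X}) (v : {ffun 'I_k.+1 -> Y}) :
  (#|[set u s | s : 'I_k.+1]| + #|[set v s | s : 'I_k.+1]| <= #|walk_edges u v|.+1)%N.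
Proof.
(* The reduction modulo [k.+1] closes the walk: [u'] returns to its starting vertex at time
   [k.+1]. *)
pose u' s := u (inord (s %% k.+1)); pose v' s := v (inord s).
apply: leq_trans (leq_trans (card_vertices_le_edges u' v' k.+1) _).
  apply: leq_add; apply: fintype.subset_leq_card; apply/fintype.subsetP => x /imsetP[s _ ->].
    rewrite (_ : u s = u' s); first by apply: mem_left_vertices; exact: ltnW.
    by rewrite /u' modn_small// inord_val.
  rewrite (_ : v s = v' s); first exact: mem_right_vertices.
  by rewrite /v' inord_val.
rewrite ltnS; apply: subset_leq_card.
suff H l : (l <= k.+1)%N -> prefix_edges u' v' l \subset walk_edges u v by exact: H.
elim: l => [|l IH] lk /=; first exact: finset.sub0set.
rewrite !finset.subUset !finset.sub1set IH ?(ltnW lk)// andbT.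
rewrite /walk_edges !inE; apply/andP; split; apply/orP; [right|left]; apply/imsetP;
  exists (inord l) => //; congr pair; rewrite /u'.
  by congr (u _); apply: val_inj; rewrite /= !inordK ?ltn_pmod.
by congr (u _); apply: val_inj; rewrite /= !inordK ?ltn_pmod// modn_small.
Qed.

(** * Trace moments of Bernoulli matrices *)

Section bernoulli_matrices.
Context {R : realType} {n m : nat} (p : R).

(* Nonnegative only if [0 <= p <= 1]; here [p = c / n], so small [n] are excluded. *)
Definition column_weight (v : {ffun 'I_n -> bool}) : R :=
  \prod_i (if v i then p else 1 - p).

Definition bool_mx (a : {ffun 'I_m -> {ffun 'I_n -> bool}}) : 'M[R]_(n, m) :=
  \matrix_(i, j) (a j i)%:R.

Lemma column_weight_ge0 v : 0 <= p <= 1 -> 0 <= column_weight v.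
Proof.
by move=> /andP[p0 p1]; apply: prodr_ge0 => i _; case: ifP; rewrite ?subr_ge0.
Qed.

Lemma column_weight_sum1 : \sum_v column_weight v = 1.
Proof.
rewrite /column_weight -(bigA_distr_bigA (fun (_ : 'I_n) (b : bool) => if b then p else 1 - p)).
by rewrite big1// => i _; rewrite big_bool /= addrC subrK.
Qed.

Lemma natr_forall_in (I : finType) (Q : pred I) (b : I -> bool) :
  \prod_(e | Q e) (b e)%:R = ([forall (e | Q e), b e])%:R :> R.
Proof.
have [/forall_inP bS|] := boolP [forall (e | Q e), b e].
  by rewrite big1// => e /bS ->.
rewrite negb_forall_in => /exists_inP[e eS /negbTE be].
by rewrite (bigD1 e)//= be mul0r.
Qed.

(** The sum factors over the entries: an edge of [S] contributes [p], any other entry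
    [p + (1 - p) = 1]. *)
Lemma prodE_edges (S : {set 'I_n * 'I_m}) :
  prodE column_weight (fun a : {ffun 'I_m -> {ffun 'I_n -> bool}} =>
    ([forall e in S, a e.2 e.1])%:R) = p ^+ #|S|.
Proof.
pose w (i : 'I_n) (j : 'I_m) (b : bool) : R :=
  (if b then p else 1 - p) * (if (i, j) \in S then b%:R else 1).
transitivity (\sum_(a : {ffun 'I_m -> {ffun 'I_n -> bool}}) \prod_j \prod_i w i j (a j i)).
  apply: eq_bigr => a _; rewrite -natr_forall_in [X in _ * X]big_mkcond /=.
  have -> : \prod_(e : 'I_n * 'I_m) (if e \in S then (a e.2 e.1)%:R else 1 : R) =
      \prod_j \prod_i (if (i, j) \in S then (a j i)%:R else 1).
    by rewrite exchange_big pair_bigA; apply: eq_bigr => -[i j].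
  rewrite -big_split.
  by apply: eq_bigr => j _; rewrite -big_split.
rewrite -(bigA_distr_bigA (fun (j : 'I_m) (v : {ffun 'I_n -> bool}) => \prod_i w i j (v i))).
under eq_bigr => j _ do rewrite -(bigA_distr_bigA (fun i b => w i j b)).
rewrite exchange_big pair_bigA /= -prodr_const [RHS]big_mkcond.
apply: eq_bigr => -[i j] _ /=; rewrite big_bool /w /=.
by case: ifP => _; rewrite ?mulr1 ?mulr0 ?addr0// addrC subrK.
Qed.

(** Entries are 0 or 1, so a walk contributes according to its set of edges, however often each one
    is traversed. *)
Lemma trace_bool_mx k a : \tr ((bool_mx a *m (bool_mx a)^T) ^+ k.+1) =
  \sum_(u : {ffun 'I_k.+1 -> 'I_n}) \sum_(v : {ffun 'I_k.+1 -> 'I_m})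
    ([forall e in walk_edges u v, a e.2 e.1])%:R.
Proof.
rewrite trace_walks; apply: eq_bigr => u _.
under eq_bigr do rewrite mxE.
rewrite bigA_distr_bigA; apply: eq_bigr => v _.
transitivity (\prod_s ((a (v s) (u s) && a (v s) (u (ordS s)))%:R : R)).
  by apply: eq_bigr => s _; rewrite !mxE -natrM mulnb.
rewrite natr_forall_in; congr (_%:R : R); congr nat_of_bool.
apply/forall_inP/forall_inP => H.
  by move=> e; rewrite inE => /orP[] /imsetP[s _ ->] /=; have /andP[] := H s isT.
move=> s _; apply/andP; split; [apply: (H (u s, v s))|apply: (H (u (ordS s), v s))];
  rewrite inE; apply/orP; [left|right]; exact: imset_f.
Qed.

Lemma prodE_trace k :
  prodE column_weight (fun a => \tr ((bool_mx a *m (bool_mx a)^T) ^+ k.+1)) =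
  \sum_(r : {ffun 'I_k.+1 -> 'I_k.+1} | ker r == r)
    \sum_(s : {ffun 'I_k.+1 -> 'I_k.+1} | ker s == s)
      (n ^_ #|[set r x | x : 'I_k.+1]|)%:R * (m ^_ #|[set s x | x : 'I_k.+1]|)%:R *
      p ^+ #|walk_edges r s|.
Proof.
under eq_prodE do rewrite trace_bool_mx.
rewrite prodE_sum.
under eq_bigr => u _.
  rewrite prodE_sum; under eq_bigr do rewrite prodE_edges card_walk_edges_ker.
  over.
rewrite (partition_big (@ker _ _) (fun r => ker r == r)) => /=; last first.
  by move=> u _; rewrite ker_ker.
apply: eq_bigr => r /eqP rr.
under eq_bigr => u /eqP ur.
  rewrite (partition_big (@ker _ _) (fun s => ker s == s)) /=; last first.
    by move=> v _; rewrite ker_ker.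
  rewrite ur.
  over.
rewrite sumr_const -sumrMnl; apply: eq_bigr => s /eqP ss.
under eq_bigr => v /eqP vs do rewrite vs.
rewrite sumr_const -mulrnA -[LHS]mulr_natl natrM mulrC mulrC; congr (_ * _).
rewrite mulrC -!card_ker//; congr (_%:R * _%:R); apply: eq_card => u; by rewrite !inE.
Qed.

End bernoulli_matrices.

(** * Growth and convergence of the moments *)

Section limit_moments.
Context {R : realType} (alpha c : R) (alpha_gt0 : 0 < alpha) (c_gt0 : 0 < c).

(* The condition #left + #right = #edges + 1 says that the walk graph is a tree. *)
Definition limit_moment (K : nat) : R :=
  if K is k.+1 then
    c^-1 ^+ K * \sum_(r : {ffun 'I_k.+1 -> 'I_k.+1} | ker r == r)
      \sum_(s : {ffun 'I_k.+1 -> 'I_k.+1} | ker s == s)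
      (let e := #|walk_edges r s| in
       let b := #|[set s x | x : 'I_k.+1]| in
       if (#|[set r x | x : 'I_k.+1]| + b == e.+1)%N then alpha ^+ b * c ^+ e else 0)
  else 1.

(** [k^k] is at most the falling factorial [(2k)(2k-1)...(k+1)], which equals [k!] times a binomial
    coefficient bounded by [2^(2k)]. *)
Lemma expn_self_le k : (k ^ k <= 4 ^ k * k`!)%N.
Proof.
apply: (@leq_trans (k.*2 ^_ k)).
  rewrite ffact_prod -[X in (X <= _)%N]muln1 -{2}(card_ord k) -prod_nat_const muln1.
  by apply: leq_prod => i _; have := ltn_ord i; lia.
rewrite -bin_ffact leq_mul2r; apply/orP; right.
rewrite (_ : 4 ^ k = 2 ^ k.*2)%N; last by rewrite -mul2n expnM.
have kk : (k < k.*2.+1)%N by lia.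
rewrite -[2%N]/(1 + 1)%N expnDn (bigD1 (Ordinal kk))//=.
by rewrite !exp1n !muln1 leq_addr.
Qed.

Lemma expn_self_sqr_le k : (k ^ k * k ^ k <= 16 ^ k * (k.*2)`!)%N.
Proof.
have kk : (k <= k.*2)%N by lia.
apply: (leq_trans (leq_mul (expn_self_le k) (expn_self_le k))).
rewrite mulnACA -expnMn leq_mul2l; apply/orP; right.
rewrite -(bin_fact kk) (_ : k.*2 - k = k)%N; last by lia.
by rewrite leq_pmull// bin_gt0.
Qed.

Lemma limit_moment_growth : exists2 C : R, 0 <= C &
  forall K, `|limit_moment K| <= C ^+ K * (K.*2)`!%:R.
Proof.
have a1 : 1 <= 1 + alpha by rewrite lerDl ltW.
have c1 : 1 <= 1 + c by rewrite lerDl ltW.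
have a0 : 0 <= 1 + alpha by exact: le_trans a1.
have c0 : 0 <= 1 + c by exact: le_trans c1.
(* A term has at most [K] column vertices and [2 K] edges, so it is at most
   [(1 + alpha)^K (1 + c)^(2K)]. There are at most [K^K K^K] pairs of kernels, whence [16^K (2K)!];
   [c^-1] is the normalization. *)
exists (c^-1 * ((1 + alpha) * (1 + c) ^+ 2) * 16).
  by rewrite !mulr_ge0 ?invr_ge0 ?exprn_ge0 ?(ltW c_gt0).
case=> [|k]; first by rewrite /= normr1 expr0 fact0 mulr1.
rewrite /limit_moment normrM ger0_norm ?exprn_ge0 ?invr_ge0 ?(ltW c_gt0)//.
set K := k.+1; rewrite !exprMn -!mulrA ler_wpM2l ?exprn_ge0 ?invr_ge0 ?(ltW c_gt0)//.
pose B : R := (1 + alpha) ^+ K * ((1 + c) ^+ K * (1 + c) ^+ K).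
have B0 : 0 <= B by rewrite !mulr_ge0 ?exprn_ge0.
have KK : K%:R ^+ K * K%:R ^+ K <= 16 ^+ K * (K.*2)`!%:R :> R.
  by rewrite -!natrX -!natrM ler_nat expn_self_sqr_le.
suff : `|\sum_(r : {ffun 'I_K -> 'I_K} | ker r == r) \sum_(s : {ffun 'I_K -> 'I_K} | ker s == s)
    (if (#|[set r x | x : 'I_K]| + #|[set s x | x : 'I_K]| == #|walk_edges r s|.+1)%N then
    alpha ^+ #|[set s x | x : 'I_K]| * c ^+ #|walk_edges r s| else 0)|
    <= B * (16 ^+ K * (K.*2)`!%:R). by rewrite /B -!mulrA.
apply: le_trans (ler_wpM2l B0 KK).
apply: le_trans (ler_norm_sum _ _ _) _.
have card_le (Q : pred {ffun 'I_K -> 'I_K}) (x : R) : 0 <= x ->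
    \sum_(r | Q r) x <= x * K%:R ^+ K.
  move=> x0; rewrite sumr_const -[leLHS]mulr_natr ler_wpM2l// -natrX ler_nat.
  by apply: leq_trans (max_card _) _; rewrite card_ffun card_ord.
rewrite mulrA; apply: le_trans (card_le _ _ _); last by rewrite mulr_ge0 ?exprn_ge0.
apply: ler_sum => r _; apply: le_trans (ler_norm_sum _ _ _) _.
apply: le_trans (card_le _ _ B0); apply: ler_sum => s _ /=.
case: ifP => _; last by rewrite normr0.
rewrite ger0_norm ?mulr_ge0 ?exprn_ge0 ?(ltW alpha_gt0) ?(ltW c_gt0)//.
apply: ler_pM; rewrite ?exprn_ge0 ?(ltW alpha_gt0) ?(ltW c_gt0)//.
  apply: (@le_trans _ _ ((1 + alpha) ^+ #|[set s x | x : 'I_K]|)).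
    by rewrite lerXn2r ?nnegrE ?(ltW alpha_gt0)// lerDr.
  rewrite ler_weXn2l//; apply: leq_trans (leq_imset_card _ _) _.
  by apply: leq_trans (max_card _) _; rewrite card_ord.
apply: (@le_trans _ _ ((1 + c) ^+ #|walk_edges r s|)).
  by rewrite lerXn2r ?nnegrE ?(ltW c_gt0)// lerDr.
rewrite -exprD ler_weXn2l//; apply: leq_trans (leq_card_setU _ _) _.
apply: leq_add; apply: leq_trans (leq_imset_card _ _) _;
  by apply: leq_trans (max_card _) _; rewrite card_ord.
Qed.

Lemma cvg_inv_nat : (n%:R^-1 : R) @[n --> \oo] --> 0.
Proof. by rewrite -cvg_shiftS; exact: cvg_harmonic. Qed.

Lemma cvg_sub_const (m : nat -> nat) (l : R) i :
  (m n)%:R / n%:R @[n --> \oo] --> l -> (m n - i)%:R / n%:R @[n --> \oo] --> l.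
Proof.
move=> ml; have h0 : (minn (m n) i)%:R / n%:R @[n --> \oo] --> (0 : R).
  apply: (@squeeze_cvgr _ _ _ _ (fun=> 0) (fun n => i%:R * n%:R^-1)).
  - apply: nearW => n; rewrite divr_ge0//= ler_wpM2r ?invr_ge0//.
    by rewrite ler_nat geq_minr.
  - exact: cvg_cst.
  - by rewrite -(mulr0 i%:R); apply: cvgM; [exact: cvg_cst|exact: cvg_inv_nat].
(* Natural subtraction is truncated: [m n - i] is [m n] minus the minimum of [m n] and [i]. *)
rewrite (_ : (fun n => _) = fun n => (m n)%:R / n%:R - (minn (m n) i)%:R / n%:R).
  by rewrite -[l]subr0; exact: cvgB.
apply/funext => n; rewrite -mulrBl; congr (_ / _).
by rewrite -natrB ?geq_minl//; congr (_%:R); lia.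
Qed.

Lemma cvg_prod_ord (I : nat) (f : 'I_I -> nat -> R) (l : R) :
  (forall i, f i n @[n --> \oo] --> l) -> \prod_i f i n @[n --> \oo] --> l ^+ I.
Proof.
elim: I f => [|I IH] f fl.
  rewrite (_ : (fun n => _) = fun=> 1); last by apply/funext => n; rewrite big_ord0.
  exact: cvg_cst.
rewrite (_ : (fun n => _) = fun n => f ord0 n * \prod_i f (lift ord0 i) n); last first.
  by apply/funext => n; rewrite big_ord_recl.
by rewrite exprS; apply: cvgM => //; apply: IH => i.
Qed.

Lemma cvg_ffact (m : nat -> nat) (l : R) a :
  (m n)%:R / n%:R @[n --> \oo] --> l ->
  (m n ^_ a)%:R / n%:R ^+ a @[n --> \oo] --> l ^+ a.
Proof.
move=> ml; rewrite (_ : (fun n => _) = fun n => \prod_(i < a) ((m n - i)%:R / n%:R)).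
  by apply: cvg_prod_ord => i; exact: cvg_sub_const.
apply/funext => n; rewrite ffact_prod natr_prod prodf_div; congr (_ / _).
by rewrite prodr_const card_ord.
Qed.

Lemma cvg_natdiv : (n%:R / n%:R : R) @[n --> \oo] --> (1 : R).
Proof.
apply: cvg_near_cst; near=> n; rewrite divff// pnatr_eq0 -lt0n.
by near: n; exists 1%N.
Unshelve. all: by end_near. Qed.

Context (m : nat -> nat) (m_alpha : (m n)%:R / n%:R @[n --> \oo] --> alpha).

(** There are about [n^a (alpha n)^b] walks of weight [(c/n)^e]. After division by [n] the power
    [n^-d] remains, where [d = e + 1 - (a + b)] vanishes exactly for trees. *)
Lemma cvg_walk_term a b e : (a + b <= e.+1)%N ->
  n%:R^-1 * ((n ^_ a)%:R * (m n ^_ b)%:R * (c / n%:R) ^+ e) @[n --> \oo] -->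
  (if (a + b == e.+1)%N then alpha ^+ b * c ^+ e else 0).
Proof.
move=> abe; pose d := (e.+1 - (a + b))%N.
have H : ((n ^_ a)%:R / n%:R ^+ a) * ((m n ^_ b)%:R / n%:R ^+ b) * c ^+ e * n%:R^-1 ^+ d
   @[n --> \oo] --> 1 ^+ a * alpha ^+ b * c ^+ e * 0 ^+ d.
  apply: cvgM; last first.
    elim: d => [|d IH].
      rewrite (_ : (fun n => _) = fun=> 1); last by apply/funext.
      exact: cvg_cst.
    rewrite exprS (_ : (fun n => _) = fun n => n%:R^-1 * n%:R^-1 ^+ d).
      by apply: cvgM => //; exact: cvg_inv_nat.
    by apply/funext => n; rewrite exprS.
  apply: cvgM; last exact: cvg_cst.
  by apply: cvgM; apply: cvg_ffact => //; exact: cvg_natdiv.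
have -> : (if (a + b == e.+1)%N then alpha ^+ b * c ^+ e else 0) =
    1 ^+ a * alpha ^+ b * c ^+ e * 0 ^+ d.
  rewrite expr1n mul1r expr0n /d subn_eq0 eqn_leq abe /=.
  by case: ifP; rewrite ?mulr1 ?mulr0.
apply: cvg_trans H; apply: near_eq_cvg; near=> n.
have n0 : n%:R != 0 :> R by rewrite pnatr_eq0 -lt0n; near: n; exists 1%N.
have ne : n%:R ^+ e.+1 = n%:R ^+ a * n%:R ^+ b * n%:R ^+ d :> R.
  by rewrite -!exprD /d subnKC.
rewrite expr_div_n exprVn.
transitivity ((n ^_ a)%:R * (m n ^_ b)%:R * c ^+ e / (n%:R ^+ a * n%:R ^+ b * n%:R ^+ d) : R).
  by field; rewrite !expf_neq0.
rewrite -ne exprS; field.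
by rewrite n0 expf_neq0.
Unshelve. all: by end_near. Qed.

End limit_moments.

(** * Polynomial approximation *)

Section weierstrass.
Context {R : realType}.
Implicit Types (f : R -> R) (g h : nat -> R) (y : R).

(* [(bernstein N g).[y]] is the expectation of [g] under the binomial law with
   parameters [N] and [y], computed by conditioning on one trial. *)
Fixpoint bernstein N g : {poly R} :=
  if N is N'.+1 then
    'X * bernstein N' (fun k => g k.+1) + (1 - 'X) * bernstein N' g
  else (g 0%N)%:P.

Lemma bernsteinS N g y : (bernstein N.+1 g).[y] =
  y * (bernstein N (fun k => g k.+1)).[y] + (1 - y) * (bernstein N g).[y].
Proof. by rewrite /= !hornerE. Qed.

Lemma le_bernstein N g h y : 0 <= y <= 1 ->
  (forall k, (k <= N)%N -> g k <= h k) ->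
  (bernstein N g).[y] <= (bernstein N h).[y].
Proof.
move=> /andP[y0 y1]; elim: N g h => [|N IH] g h gh.
  by rewrite /= !hornerE gh.
rewrite !bernsteinS lerD// ler_wpM2l ?subr_ge0//; apply: IH => k kN; apply: gh => //.
exact: leqW.
Qed.

Lemma bernsteinD N g h y :
  (bernstein N (fun k => g k + h k)).[y] = (bernstein N g).[y] + (bernstein N h).[y].
Proof.
elim: N g h => [|N IH] g h; first by rewrite /= !hornerE.
by rewrite !bernsteinS !IH; ring.
Qed.

Lemma bernsteinZ N a g y :
  (bernstein N (fun k => a * g k)).[y] = a * (bernstein N g).[y].
Proof.
elim: N g => [|N IH] g; first by rewrite /= !hornerE.
by rewrite !bernsteinS !IH; ring.
Qed.

Lemma bernstein_cst N a y : (bernstein N (fun=> a)).[y] = a.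
Proof.
elim: N => [|N IH]; first by rewrite /= !hornerE.
by rewrite bernsteinS IH; ring.
Qed.

(** Variance plus squared bias of the binomial law. The centre [a] is left free because conditioning
    on a success shifts it by one. *)
Lemma bernstein_sqr N a y : (bernstein N (fun k => (k%:R - a) ^+ 2)).[y] =
  N%:R * (y * (1 - y)) + (N%:R * y - a) ^+ 2.
Proof.
elim: N a => [|N IH] a; first by rewrite /= hornerC; ring.
rewrite bernsteinS IH (_ : (fun k => _) = (fun k => (k%:R - (a - 1)) ^+ 2)).
  by rewrite IH -natr1; ring.
by apply/funext => k; rewrite -natr1; ring.
Qed.

Lemma uniform_continuity01 f (e : R) : {within `[0, 1], continuous f} -> 0 < e ->
  exists2 d : R, 0 < d & forall x y : R, 0 <= x <= 1 -> 0 <= y <= 1 ->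
    `|x - y| < d -> `|f x - f y| < e.
Proof.
move=> /subspace_continuousP cf e0.
have /compact_near_coveringP cov := @segment_compact R 0 1.
(* Near-covering compactness turns a [d] valid near each [x] into one valid on the whole segment;
   below, the radius is halved so that the same [d] serves all [z] close to [x]. *)
pose P (d x : R) := 0 <= x <= 1 -> forall y, 0 <= y <= 1 -> `|x - y| < d -> `|f x - f y| < e.
have [] := cov R (0^'+) P _.
  move=> x x01.
  have /cvgrPdist_lt/(_ (e / 2)) := cf x x01.
  rewrite divr_gt0// => /(_ isT); rewrite near_withinE => -[r /= r0 xr].
  have hr z : 0 <= z <= 1 -> `|x - z| < r -> `|f x - f z| < e / 2.
    by move=> z01 xz; apply: xr => //=; rewrite in_itv.
  exists (ball x (r / 2), [set d | d < r / 2]).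
    split; first by apply: nbhsx_ballx; rewrite divr_gt0.
    by apply: nbhs_right_lt; rewrite divr_gt0.
  move=> [z d] [/= xz dr] z01 y y01 zy.
  have xz' : `|x - z| < r / 2 by exact: xz.
  have zr : `|x - z| < r by lra.
  have h2 : `|x - y| < r.
    by apply: le_lt_trans (ler_distD z _ _) _; have := lt_trans zy dr; lra.
  apply: le_lt_trans (ler_distD (f x) _ _) _; rewrite distrC.
  by have := hr z z01 zr; have := hr y y01 h2; lra.
move=> d /= d0 H; exists (d / 2); first by rewrite divr_gt0.
move=> x y x01 y01 xy; apply: (H (d / 2)) xy => //=.
- by rewrite sub0r normrN gtr0_norm ?divr_gt0// ltr_pdivrMr// ltr_pMr// ltr1n.
- by rewrite divr_gt0.
Qed.

Lemma weierstrass01 f (e : R) : {within `[0, 1], continuous f} -> 0 < e ->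
  exists p : {poly R}, forall y, 0 <= y <= 1 -> `|f y - p.[y]| <= e.
Proof.
move=> cf e0.
have [B B0 fB] : exists2 B : R, 0 <= B & forall y, 0 <= y <= 1 -> `|f y| <= B.
  have /compact_bounded[M [_ MB]] := continuous_compact cf (@segment_compact R 0 1).
  exists (`|M| + 1); first by rewrite addr_ge0.
  move=> y y01; apply: (MB (`|M| + 1)); first by rewrite (le_lt_trans (ler_norm _))// ltrDl.
  by exists y => //=; rewrite in_itv.
have [d d0 fd] := uniform_continuity01 cf (divr_gt0 e0 (ltr0Sn _ 1)).
(* With [N > 4 B / (d^2 e)], and since [y (1 - y) <= 1], the variance term
   [2 B / (d^2 N) * y (1 - y)] is at most [e / 2]. *)
have A0 : 0 <= 4 * B / (d ^+ 2 * e) by apply: divr_ge0; [rewrite mulr_ge0|rewrite mulr_ge0 ?sqr_ge0 ?ltW].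
have := Num.Theory.archi_boundP A0; set N := Num.bound _ => AN.
have N0 : 0 < N%:R :> R by exact: le_lt_trans AN.
exists (bernstein N (fun k => f (k%:R / N%:R))) => y y01.
set p := bernstein _ _.
(* Chebyshev's argument as a pointwise majorant: within distance [d] the error is below [e / 2], and
   beyond it [2 B] is at most [2 B (|y - k/N| / d)^2]. *)
pose E k : R := e / 2 + 2 * B / (d ^+ 2 * N%:R ^+ 2) * (k%:R - N%:R * y) ^+ 2.
have EN : (bernstein N E).[y] <= e.
  rewrite /E bernsteinD bernstein_cst bernsteinZ bernstein_sqr subrr expr0n addr0.
  have y1 : y * (1 - y) <= 1 by move/andP: y01 => [y0 y1]; nra.
  have -> : 2 * B / (d ^+ 2 * N%:R ^+ 2) * (N%:R * (y * (1 - y))) =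
    2 * B / (d ^+ 2 * N%:R) * (y * (1 - y)) by field; rewrite !gt_eqF.
  have h : 2 * B / (d ^+ 2 * N%:R) <= e / 2.
    rewrite ler_pdivrMr ?mulr_gt0 ?exprn_gt0//.
    move: AN; rewrite ltr_pdivrMr ?mulr_gt0 ?exprn_gt0//; lra.
  have h0 : 0 <= 2 * B / (d ^+ 2 * N%:R) by apply: divr_ge0; rewrite mulr_ge0 ?sqr_ge0 ?ler0n.
  have : 2 * B / (d ^+ 2 * N%:R) * (y * (1 - y)) <= 2 * B / (d ^+ 2 * N%:R) * 1.
    by rewrite ler_wpM2l.
  lra.
have key k : (k <= N)%N -> `|f y - f (k%:R / N%:R)| <= E k.
  move=> kN; have k01 : 0 <= (k%:R / N%:R : R) <= 1.
    by rewrite divr_ge0//= ler_pdivrMr// mul1r ler_nat.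
  have E0 : 0 <= 2 * B / (d ^+ 2 * N%:R ^+ 2) * (k%:R - N%:R * y) ^+ 2.
    by rewrite mulr_ge0 ?sqr_ge0//; apply: divr_ge0; rewrite mulr_ge0 ?sqr_ge0.
  have [yk|yk] := ltP `|y - k%:R / N%:R| d.
    by apply: le_trans (ltW (fd _ _ y01 k01 yk)) _; rewrite lerDl.
  apply: (@le_trans _ _ (2 * B)).
    apply: le_trans (ler_normB _ _) _.
    by have := fB _ y01; have := fB _ k01; lra.
  have EE : 2 * B / (d ^+ 2 * N%:R ^+ 2) * (k%:R - N%:R * y) ^+ 2 =
     2 * B * ((y - k%:R / N%:R) ^+ 2 / d ^+ 2) by field; rewrite !gt_eqF.
  apply: (@le_trans _ _ (2 * B * ((y - k%:R / N%:R) ^+ 2 / d ^+ 2))); last by rewrite /E EE; lra.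
  rewrite ler_peMr ?mulr_ge0// ler_pdivlMr ?exprn_gt0// mul1r.
  by rewrite -[leRHS]real_normK ?num_real// lerXn2r// nnegrE// ltW.
rewrite -[f y](bernstein_cst N (f y) y) -mulN1r -bernsteinZ -bernsteinD ler_norml.
apply/andP; split.
  rewrite lerNl; apply: le_trans EN.
  rewrite -[leLHS]mulN1r -bernsteinZ; apply: le_bernstein => // k kN.
  by rewrite mulN1r mulN1r opprB; apply: le_trans (ler_norm _) _; rewrite distrC key.
apply: le_trans EN; apply: le_bernstein => // k kN.
by rewrite mulN1r (le_trans (ler_norm _))// key.
Qed.

End weierstrass.

(** * Determinacy of the moment problem *)

Section cosine_taylor.
Context {R : realType}.
Implicit Types (a b s t : R) (i r : nat).

Lemma ge0_of_derive_ge0 (g g' : R -> R) (b : R) :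
  (forall x : R, is_derive x (1 : R) g (g' x)) -> (forall x, 0 <= x -> 0 <= g' x) ->
  g 0 = 0 -> 0 <= b -> 0 <= g b.
Proof.
move=> dg g'0 g0 b0; rewrite -g0.
have dr x : derivable g x 1 by have := dg x => -[].
apply: (@ger0_derive1_le_cc _ g 0 b) => //.
- move=> x; rewrite in_itv/= => /andP[x0 _]; rewrite derive1E.
  by have -> := @derive_val _ _ _ _ _ _ _ (dg x); rewrite g'0// ltW.
- apply: derivable_within_continuous => x _; exact: dr.
- by rewrite in_itv/= lexx b0.
- by rewrite in_itv/= b0 lexx.
Qed.

(* the [i]-th derivative of the cosine *)
Definition cosder i t : R := cos (t + i%:R * (pi / 2)).

Lemma cosder_le1 i t : `|cosder i t| <= 1. Proof. exact: cos_max. Qed.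

Lemma cosderSS i t : cosder i.+2 t = - cosder i t.
Proof.
rewrite /cosder -cosDpi; congr cos.
by rewrite -addrA; congr (_ + _); rewrite -natr1 -natr1; field.
Qed.

Lemma cosder_shift2 i l t : cosder (i + l.*2) t = (-1) ^+ l * cosder i t.
Proof.
elim: l => [|l IH]; first by rewrite addn0 expr0 mul1r.
by rewrite doubleS !addnS cosderSS IH exprS mulN1r mulNr.
Qed.

Lemma is_derive_cosder i t : is_derive t (1 : R) (cosder i) (cosder i.+1 t).
Proof.
rewrite /cosder.
have -> : cos (t + i.+1%:R * (pi / 2)) = - sin (t + i%:R * (pi / 2)).
  by rewrite -cosDpihalf; congr cos; rewrite -natr1; field.
have := @is_derive1_comp R cos (fun x => x + i%:R * (pi / 2)) t _ 1
   (is_derive_cos _) _.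
rewrite mulr1; apply.
exact: is_derive_shift.
Qed.

(** The Taylor remainder of order [r] at [a], for the [i]-th derivative and increment [b]. *)
Definition cos_rem i r a b : R :=
  cosder i (a + b) - \sum_(l < r) b ^+ l / l`!%:R * cosder (i + l) a.

Lemma is_derive_expfact r b :
  is_derive b (1 : R) (fun x : R => x ^+ r.+1 / r.+1`!%:R) (b ^+ r / r`!%:R).
Proof.
have /= dX := @is_deriveX R R id r.+1 b 1 1 (is_derive_id _ _).
have := is_deriveZ (r.+1`!%:R^-1) dX.
rewrite (_ : _ \*: _ = fun x : R => x ^+ r.+1 / r.+1`!%:R); last first.
  by apply/funext => x /=; rewrite exprfctE mulrC.
move=> /is_derive_eq; apply; rewrite /= factS natrM /GRing.scale /= mulr1.
by rewrite invfM mulrACA mulVf ?pnatr_eq0// mul1r mulrC.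
Qed.

Lemma is_derive_cos_rem i r a b :
  is_derive b (1 : R) (cos_rem i r.+1 a) (cos_rem i.+1 r a b).
Proof.
rewrite /cos_rem; apply: is_deriveB.
  have := @is_derive1_comp R (cosder i) (fun x => a + x) b _ 1 (is_derive_cosder _ _) _.
  rewrite mulr1; apply; rewrite (_ : (fun x => a + x) = shift a).
    exact: is_derive_shift.
  by apply/funext => x; rewrite addrC.
have dl (l : 'I_r.+1) : is_derive b (1 : R) (fun x : R => x ^+ l / l`!%:R * cosder (i + l) a)
   (if l is Ordinal l'.+1 _ then b ^+ l' / l'`!%:R * cosder (i.+1 + l') a else 0).
  case: l => -[|l] ll /=.
    rewrite (_ : (fun x => _) = cst (cosder (i + 0) a)); first exact: is_derive_cst.
    by apply/funext => x; rewrite expr0 fact0 divr1 mul1r.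
  have := is_deriveZ (cosder (i + l.+1) a) (is_derive_expfact l b).
  rewrite (_ : _ \*: _ = fun x : R => x ^+ l.+1 / l.+1`!%:R * cosder (i + l.+1) a).
    by move=> /is_derive_eq; apply; rewrite /GRing.scale/= mulrC addnS addSn.
  by apply/funext => x; rewrite [RHS]mulrC.
have := is_derive_sum dl.
rewrite [X in is_derive _ _ _ X]big_ord_recl /= add0r => ds.
rewrite (_ : (fun x => _) = \sum_(l < r.+1) (fun x : R => x ^+ l / l`!%:R * cosder (i + l) a)).
  by apply: (is_derive_eq ds); apply: eq_bigr => l _.
by apply/funext => x; rewrite fct_sumE.
Qed.

(** Differentiating in [b] lowers the order [r] and raises [i] by one. All derivatives are therefore
    treated together, and the bound for order [r] is integrated by monotonicity. *)
Lemma cos_rem_bound r i a b : 0 <= b -> `|cos_rem i r a b| <= b ^+ r / r`!%:R.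
Proof.
elim: r i b => [|r IH] i b b0.
  by rewrite /cos_rem big_ord0 subr0 expr0 fact0 divr1 cosder_le1.
have rem0 : cos_rem i r.+1 a 0 = 0.
  rewrite /cos_rem big_ord_recl /= expr0 fact0 divr1 mul1r addn0 addr0.
  by rewrite big1 ?addr0 ?subrr// => l _; rewrite exprS !mul0r.
rewrite ler_norml lerNl -subr_ge0 opprK -(subr_ge0 (cos_rem _ _ _ _)).
apply/andP; split.
  apply: (@ge0_of_derive_ge0 (fun x => x ^+ r.+1 / r.+1`!%:R + cos_rem i r.+1 a x)
    (fun x => x ^+ r / r`!%:R + cos_rem i.+1 r a x)) => //.
  - move=> x; apply: is_deriveD; [exact: is_derive_expfact|exact: is_derive_cos_rem].
  - by move=> x x0; have := IH i.+1 x x0; rewrite ler_norml => /andP[]; lra.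
  - by rewrite rem0 exprS !mul0r addr0.
apply: (@ge0_of_derive_ge0 (fun x => x ^+ r.+1 / r.+1`!%:R - cos_rem i r.+1 a x)
    (fun x => x ^+ r / r`!%:R - cos_rem i.+1 r a x)) => //.
- move=> x; apply: is_deriveB; [exact: is_derive_expfact|exact: is_derive_cos_rem].
- by move=> x x0; have := IH i.+1 x x0; rewrite ler_norml => /andP[]; lra.
- by rewrite rem0 exprS !mul0r subr0.
Qed.

End cosine_taylor.

Section moment_approximation.
Context {R : realType} (M : nat -> R).
Implicit Types (p q : {poly R}) (f g : R -> R).

Definition moment_functional p : R := \sum_(i < size p) p`_i * M i.
Local Notation mom := moment_functional.

Lemma momentE N p : (size p <= N)%N -> mom p = \sum_(i < N) p`_i * M i.
Proof.
move=> pN; rewrite /mom (big_ord_widen _ (fun i => p`_i * M i) pN) big_mkcond.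
by apply: eq_bigr => i _; case: ltnP => // ip; rewrite nth_default// mul0r.
Qed.

Lemma momentD p q : mom (p + q) = mom p + mom q.
Proof.
set N := maxn (size p) (size q).
rewrite (@momentE N (p + q)) ?size_polyD// (@momentE N p) ?leq_maxl//.
rewrite (@momentE N q) ?leq_maxr// -big_split.
by apply: eq_bigr => i _; rewrite coefD mulrDl.
Qed.

Lemma momentZ k p : mom (k *: p) = k * mom p.
Proof.
rewrite (@momentE (size p) (k *: p)) ?size_scale_leq// mulr_sumr.
by apply: eq_bigr => i _; rewrite coefZ mulrA.
Qed.

Lemma momentXn k : mom 'X^k = M k.
Proof.
rewrite /mom size_polyXn big_ord_recr /= big1 ?add0r => [|i _].
  by rewrite coefXn eqxx mul1r.
by rewrite coefXn ltn_eqF ?mul0r.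
Qed.

Lemma moment0 : mom 0 = 0.
Proof. by rewrite /mom size_poly0 big_ord0. Qed.

(** The error has a polynomial majorant [q] on the half-line, whose size is read off from the formal
    functional alone; [M] need not yet come from a measure. *)
Definition moment_approx f := forall e : R, 0 < e ->
  exists p q, (forall x, 0 <= x -> `|f x - p.[x]| <= q.[x]) /\ mom q <= e.

Lemma moment_approx_ext f g : (forall x, 0 <= x -> f x = g x) ->
  moment_approx f -> moment_approx g.
Proof.
move=> fg af e e0; have [p [q [fpq qe]]] := af e e0.
by exists p, q; split=> // x x0; rewrite -fg// fpq.
Qed.

Lemma moment_approx_poly p : moment_approx (fun x => p.[x]).
Proof.
move=> e e0; exists p, 0; split => [x _|]; first by rewrite subrr normr0 horner0.
by rewrite moment0 ltW.
Qed.

Lemma moment_approxD f g : moment_approx f -> moment_approx g ->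
  moment_approx (fun x => f x + g x).
Proof.
move=> af ag e e0; have e20 : 0 < e / 2 by rewrite divr_gt0.
have [p [q [fp qe]]] := af _ e20; have [p' [q' [gp qe']]] := ag _ e20.
exists (p + p'), (q + q'); split => [x x0|]; last by rewrite momentD; lra.
by rewrite !hornerD opprD addrACA (le_trans (ler_normD _ _))// lerD ?fp ?gp.
Qed.

Lemma moment_approxZ k f : moment_approx f -> moment_approx (fun x => k * f x).
Proof.
move=> af e e0; have k0 : 0 < `|k| + 1 by rewrite ltr_wpDl.
have [p [q [fp qe]]] := af _ (divr_gt0 e0 k0).
exists (k *: p), (`|k| *: q); split => [x x0|].
  by rewrite !hornerZ -mulrBr normrM ler_wpM2l ?fp.
rewrite momentZ (le_trans (ler_wpM2l (normr_ge0 k) qe))//.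
by rewrite mulrCA ger_pMr// ler_pdivrMr// mul1r lerDl.
Qed.

Lemma moment_approx_sum n (F : 'I_n -> R -> R) : (forall i, moment_approx (F i)) ->
  moment_approx (fun x => \sum_i F i x).
Proof.
elim: n F => [|n IH] F aF.
  apply: (@moment_approx_ext (fun x => (0 : {poly R}).[x])); last exact: moment_approx_poly.
  by move=> x _; rewrite horner0 big_ord0.
apply: (@moment_approx_ext (fun x => F ord0 x + \sum_i F (lift ord0 i) x)).
  by move=> x _; rewrite big_ord_recl.
by apply: moment_approxD => //; apply: IH => i.
Qed.

Lemma moment_approx_close f : (forall e : R, 0 < e -> exists g q,
   [/\ moment_approx g, forall x, 0 <= x -> `|f x - g x| <= q.[x] & mom q <= e]) ->
  moment_approx f.
Proof.
move=> af e e0; have e20 : 0 < e / 2 by rewrite divr_gt0.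
have [g [q [ag fg qe]]] := af _ e20; have [p [q' [gp qe']]] := ag _ e20.
exists p, (q + q'); split => [x x0|]; last by rewrite momentD; lra.
by rewrite hornerD (le_trans (ler_distD (g x) _ _))// lerD ?fg ?gp.
Qed.

Context (C : R) (C_ge0 : 0 <= C) (M_growth : forall k, `|M k| <= C ^+ k * (k.*2)`!%:R).

Lemma cosder_odd0 l : cosder l.*2.+1 0 = 0 :> R.
Proof.
rewrite -addn1 addnC cosder_shift2 /cosder add0r mul1r.
by rewrite cos_pihalf mulr0.
Qed.

(** For even [i] an integer power of [x] appears, and odd derivatives of the cosine vanish at 0.
    This parity is why cosines are used. *)
Lemma moment_approx_cosder0 i :
  moment_approx (fun x => Num.sqrt x ^+ i * cosder i (0 * Num.sqrt x)).
Proof.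
have [[l ->]|[l ->]] : (exists l, i = l.*2) \/ (exists l, i = l.*2.+1).
- by rewrite -(odd_double_half i); case: odd; [right|left]; exists i./2.
- apply: (@moment_approx_ext (fun x => (cosder l.*2 0 *: 'X^l).[x])); last first.
    exact: moment_approx_poly.
  move=> x x0; rewrite hornerZ hornerXn mul0r mulrC; congr (_ * _).
  by rewrite -mul2n exprM sqr_sqrtr.
apply: (@moment_approx_ext (fun x => (0 : {poly R}).[x])); last exact: moment_approx_poly.
by move=> x x0; rewrite horner0 mul0r cosder_odd0 mulr0.
Qed.

Lemma pow_half_small (A e : R) : 0 <= A -> 0 < e -> exists r, A * 2^-1 ^+ r <= e.
Proof.
move=> A0 e0; exists (Num.bound (A / e)).
have Ae : 0 <= A / e by rewrite divr_ge0// ltW.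
have := archi_boundP Ae; set r := Num.bound _ => Ar.
rewrite exprVn ler_pdivrMr ?exprn_gt0// mulrC -ler_pdivrMr//.
apply: ltW; apply: lt_le_trans Ar _.
by rewrite -natrX ler_nat ltnW// ltn_expl.
Qed.

Lemma factorial_ratio i r : (((i + r).*2)`! <= 4 ^ (i + r) * i`! * (i + r.*2)`!)%N.
Proof.
have e : ((i + r).*2 - i = i + r.*2)%N by lia.
have le_i : (i <= (i + r).*2)%N by lia.
rewrite -(bin_fact le_i) e -mulnA leq_mul2r; apply/orP; right.
rewrite (_ : 4 ^ (i + r) = 2 ^ (i + r).*2)%N; last by rewrite -mul2n expnM.
rewrite -[2%N]/(1 + 1)%N expnDn (bigD1 (Ordinal (le_i : i < (i + r).*2.+1)%N))//=.
by rewrite !exp1n !muln1 leq_addr.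
Qed.

(** The Taylor order is [l = i + 2 r], so that the remainder carries [sqrt x ^ (i + l) = x^(i + r)],
    a polynomial. The factor [1 / l!] beats [(2 (i + r))!] up to [4^(i + r) i!], which leaves
    [i! (4 C h)^i (4 C h^2)^r]. *)
Lemma moment_approx_cosder_step s h : 0 <= h -> 4 * C * h ^+ 2 <= 2^-1 ->
  (forall i, moment_approx (fun x => Num.sqrt x ^+ i * cosder i (s * Num.sqrt x))) ->
  (forall i, moment_approx (fun x => Num.sqrt x ^+ i * cosder i ((s + h) * Num.sqrt x))).
Proof.
move=> h0 hC as_ i; apply: moment_approx_close => e e0.
have [r re] := @pow_half_small (i`!%:R * (4 * C * h) ^+ i) e
  (mulr_ge0 (ler0n _ _) (exprn_ge0 _ (mulr_ge0 (mulr_ge0 (ler0n _ 4) C_ge0) h0))) e0.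
set l := (i + r.*2)%N.
exists (fun x => \sum_(k < l) h ^+ k / k`!%:R *
   (Num.sqrt x ^+ (i + k) * cosder (i + k) (s * Num.sqrt x))).
exists ((h ^+ l / l`!%:R) *: 'X^(i + r)); split.
- by apply: moment_approx_sum => k; exact: moment_approxZ.
- move=> x x0; have sx := sqrtr_ge0 x.
  have -> : Num.sqrt x ^+ i * cosder i ((s + h) * Num.sqrt x) -
     \sum_(k < l) h ^+ k / k`!%:R * (Num.sqrt x ^+ (i + k) * cosder (i + k) (s * Num.sqrt x))
     = Num.sqrt x ^+ i * cos_rem i l (s * Num.sqrt x) (h * Num.sqrt x).
    rewrite /cos_rem mulrBr mulrDl; congr (_ - _); rewrite mulr_sumr.
    by apply: eq_bigr => k _; rewrite exprD exprMn; ring.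
  rewrite normrM ger0_norm ?exprn_ge0//.
  apply: le_trans (ler_wpM2l (exprn_ge0 _ sx) (cos_rem_bound _ _ _ (mulr_ge0 h0 sx))) _.
  rewrite hornerZ hornerXn exprMn -{3}(sqr_sqrtr x0) -exprM.
  rewrite (_ : (2 * (i + r) = i + l)%N); last by rewrite /l; lia.
  by rewrite exprD le_eqVlt; apply/orP; left; apply/eqP; ring.
rewrite momentZ momentXn; apply: le_trans re.
apply: le_trans (ler_wpM2l _ (le_trans (ler_norm _) (M_growth (i + r)))) _.
  by rewrite divr_ge0 ?exprn_ge0.
have lf : 0 < l`!%:R :> R by rewrite ltr0n fact_gt0.
have ratio : ((i + r).*2)`!%:R <= 4 ^+ (i + r) * i`!%:R * l`!%:R :> R.
  by rewrite -!natrX -!natrM ler_nat factorial_ratio.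
apply: (@le_trans _ _ (h ^+ l / l`!%:R * (C ^+ (i + r) * (4 ^+ (i + r) * i`!%:R * l`!%:R)))).
  by rewrite ler_wpM2l ?divr_ge0 ?exprn_ge0// ler_wpM2l ?exprn_ge0.
have -> : h ^+ l / l`!%:R * (C ^+ (i + r) * (4 ^+ (i + r) * i`!%:R * l`!%:R)) =
   i`!%:R * (4 * C * h) ^+ i * (4 * C * h ^+ 2) ^+ r.
  have -> : h ^+ l = h ^+ i * (h ^+ 2) ^+ r by rewrite /l exprD -mul2n exprM.
  rewrite !exprMn !exprD; move: (lt0r_neq0 lf); move: l`!%:R (4 ^+ i) (4 ^+ r)
    (C ^+ i) (C ^+ r) (h ^+ i) (h ^+ 2 ^+ r) i`!%:R => x1 x2 x3 x4 x5 x6 x7 x8 x10.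
  by field.
rewrite ler_wpM2l ?mulr_ge0 ?exprn_ge0 ?mulr_ge0//.
by rewrite lerXn2r// nnegrE// ?mulr_ge0 ?sqr_ge0.
Qed.

Lemma moment_approx_cosder s i : 0 <= s ->
  moment_approx (fun x => Num.sqrt x ^+ i * cosder i (s * Num.sqrt x)).
Proof.
(* [N] steps of length [h = s / N] with [h (8 C + 1) <= 1]: then [h <= 1] and [8 C h <= 1], hence
   [4 C h^2 <= 1/2]. *)
move=> s0; have A0 : 0 <= s * (8 * C + 1) + 1.
  by rewrite addr_ge0// mulr_ge0// addr_ge0// mulr_ge0.
have := archi_boundP A0; set N := Num.bound _ => AN.
have N0 : 0 < N%:R :> R by exact: le_lt_trans AN.
set h := s / N%:R.
have h0 : 0 <= h by rewrite divr_ge0.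
have hC : 4 * C * h ^+ 2 <= 2^-1.
  have h1 : h * (8 * C + 1) <= 1.
    by rewrite /h mulrAC ler_pdivrMr// mul1r; lra.
  by nra.
have -> : s = N%:R * h by rewrite /h mulrC divfK// gt_eqF.
move: h h0 hC => h h0 hC; clearbody N; clear AN N0 A0 s0.
elim: N i => [|k IH] j; first by rewrite mul0r; exact: moment_approx_cosder0.
rewrite -natr1 mulrDl mul1r.
by apply: moment_approx_cosder_step.
Qed.

(** Product-to-sum formula by induction on [j]; the extra factor of arbitrary frequency [s] absorbs
    one power at a time. Evenness of the cosine keeps the frequency [|s - th|] nonnegative. *)
Lemma moment_approx_cosX th j s : 0 <= th -> 0 <= s ->
  moment_approx (fun x => cos (th * Num.sqrt x) ^+ j * cos (s * Num.sqrt x)).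
Proof.
move=> th0; elim: j s => [|j IH] s s0.
  apply: (@moment_approx_ext (fun x => Num.sqrt x ^+ 0 * cosder 0 (s * Num.sqrt x))).
    by move=> x x0; rewrite /cosder mul0r addr0.
  exact: moment_approx_cosder.
apply: (@moment_approx_ext (fun x => 2^-1 * (cos (th * Num.sqrt x) ^+ j * cos ((s + th) * Num.sqrt x)
  + cos (th * Num.sqrt x) ^+ j * cos (`|s - th| * Num.sqrt x)))).
  move=> x x0; have -> : cos (`|s - th| * Num.sqrt x) = cos ((s - th) * Num.sqrt x).
    by rewrite -{1}(ger0_norm (sqrtr_ge0 x)) -normrM cos_norm.
  rewrite mulrDl mulrBl cosD cosB exprSr; by field.
by apply: moment_approxZ; apply: moment_approxD; apply: IH => //; exact: addr_ge0.
Qed.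

Lemma moment_approx_poly_cos th p : 0 <= th ->
  moment_approx (fun x => p.[(1 + cos (th * Num.sqrt x)) / 2]).
Proof.
move=> th0; set r := p \Po (2^-1 *: (1 + 'X)).
apply: (@moment_approx_ext (fun x => \sum_(i < size r) r`_i *
   (cos (th * Num.sqrt x) ^+ i * cos (0 * Num.sqrt x)))).
  move=> x x0; rewrite [RHS](_ : _ = r.[cos (th * Num.sqrt x)]).
    by rewrite horner_coef; apply: eq_bigr => i _; rewrite mul0r cos0 mulr1.
  by rewrite /r horner_comp; congr (p.[_]); rewrite !hornerE mulrC.
by apply: moment_approx_sum => i; apply: moment_approxZ; exact: moment_approx_cosX.
Qed.

Lemma continuous_acos_affine :
  {within `[0, 1], continuous (fun y : R => acos (2 * y - 1))}.
Proof.
pose f (t : R) := (1 + cos t) / 2.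
have f0 : f 0 = 1 by rewrite /f cos0; lra.
have fpi : f pi = 0 by rewrite /f cospi; lra.
have := @segment_can_ge_continuous R 0 pi f (fun y => acos (2 * y - 1)) (pi_ge0 R).
rewrite f0 fpi; apply.
- apply: continuous_subspaceT => t; apply: cvgM; last exact: cvg_cst.
  by apply: cvgD; [exact: cvg_cst|exact: continuous_cos].
- move=> t tpi; rewrite /f mulrC divfK// addrC addKr.
  exact: cosK.
Qed.

Lemma moment_approx_bounded_continuous f B : continuous f ->
  (forall x, `|f x| <= B) -> moment_approx f.
Proof.
move=> cf fB; apply: moment_approx_close => e e0.
have B0 : 0 <= B by exact: le_trans (normr_ge0 (f 0)) (fB 0).
have M0 : M 0%N <= 1.
  by apply: le_trans (ler_norm _) (le_trans (M_growth 0) _); rewrite expr0 fact0 mulr1.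
have M1 : M 1%N <= C * 2.
  by apply: le_trans (ler_norm _) (le_trans (M_growth 1) _); rewrite expr1.
(* Makes the tail mass [2 B M_1 / K^2 <= 4 B C / K^2] at most [e / 2]; the summand 1 ensures
   [K <= K^2]. *)
pose K : R := 8 * B * C / e + 1.
have K1 : 1 <= K by rewrite /K lerDr divr_ge0 ?mulr_ge0// ltW.
have K0 : 0 < K by exact: lt_le_trans K1.
have pi0 := pi_gt0 R.
(* For [sqrt x <= K], [phi] recovers [f x] from [y = (1 + cos (pi sqrt x / K)) / 2], since [acos]
   inverts the cosine on [[0, pi]]. *)
pose phi (y : R) := f ((K / pi * acos (2 * y - 1)) ^+ 2).
have cphi : {within `[0, 1], continuous phi}.
  have /subspace_continuousP ca := continuous_acos_affine.
  apply/subspace_continuousP => y y01.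
  apply: (cvg_comp (fun y : R => (K / pi * acos (2 * y - 1)) ^+ 2) f); last exact: cf.
  have cg : (fun y : R => K / pi * acos (2 * y - 1)) @ within `[0, 1] (nbhs y) --> K / pi * acos (2 * y - 1).
    by apply: cvgM; [exact: cvg_cst|exact: ca].
  rewrite expr2 (_ : (fun y => _) = (fun y : R => (K / pi * acos (2 * y - 1)) *
    (K / pi * acos (2 * y - 1)))); last by apply/funext => z; rewrite expr2.
  exact: cvgM.
have [P phiP] := weierstrass01 cphi (divr_gt0 e0 (ltr0Sn _ 1)).
exists (fun x => P.[(1 + cos (pi / K * Num.sqrt x)) / 2]).
exists ((e / 2)%:P + (2 * B / K ^+ 2) *: 'X); split.
- by apply: moment_approx_poly_cos; rewrite divr_ge0 ?ltW.
- move=> x x0; set Y := (1 + _) / 2.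
  have Y01 : 0 <= Y <= 1.
    have := cos_geN1 (pi / K * Num.sqrt x); have := cos_le1 (pi / K * Num.sqrt x).
    by rewrite /Y => h1 h2; apply/andP; split; lra.
  apply: le_trans (ler_distD (phi Y) _ _) _.
  rewrite hornerD hornerC hornerZ hornerX addrC lerD ?phiP//.
  have K20 : 0 < K ^+ 2 by rewrite exprn_gt0.
  have [xK|xK] := leP (Num.sqrt x) K.
    have -> : phi Y = f x.
      rewrite /phi (_ : 2 * Y - 1 = cos (pi / K * Num.sqrt x)); last by rewrite /Y; lra.
      rewrite cosK.
        congr f; rewrite -[RHS](sqr_sqrtr x0); congr (_ ^+ 2).
        by rewrite !mulrA divfK ?divff ?mul1r// gt_eqF.
      rewrite in_itv/= mulr_ge0 ?divr_ge0 ?sqrtr_ge0 ?(ltW pi0) ?(ltW K0)//=.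
      apply: (@le_trans _ _ (pi / K * K)); last by rewrite divfK// gt_eqF.
      by rewrite ler_wpM2l// divr_ge0 ?ltW.
    by rewrite subrr normr0 mulr_ge0// divr_ge0 ?sqr_ge0// mulr_ge0.
  (* Beyond [K] periodicity destroys the agreement, but there [2 B <= 2 B x / K^2]. *)
  apply: (@le_trans _ _ (2 * B)).
    by apply: le_trans (ler_normB _ _) _; have := fB x; have := fB ((K / pi * acos (2 * Y - 1)) ^+ 2); rewrite -/(phi Y); lra.
  rewrite -[leRHS]mulrA ler_peMr ?mulr_ge0// mulrC ler_pdivlMr// mul1r.
  by rewrite -[leRHS](sqr_sqrtr x0) lerXn2r ?nnegrE ?sqrtr_ge0 ?(ltW K0) ?(ltW xK).
rewrite momentD momentZ -['X]expr1 momentXn -[(e / 2)%:P]mulr1 mul_polyC momentZ.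
rewrite -(expr0 'X) momentXn.
have : e / 2 * M 0%N <= e / 2 by rewrite ler_piMr// divr_ge0// ltW.
suff : 2 * B / K ^+ 2 * M 1%N <= e / 2 by lra.
have K20 : 0 < K ^+ 2 by rewrite exprn_gt0.
rewrite mulrAC ler_pdivrMr//.
apply: (@le_trans _ _ (2 * B * (C * 2))); first by rewrite ler_wpM2l// mulr_ge0.
apply: (@le_trans _ _ (e / 2 * K)); last first.
  by rewrite ler_wpM2l ?divr_ge0 ?(ltW e0)// expr2 ler_peMr// (ltW K0).
have -> : e / 2 * K = 4 * B * C + e / 2 by rewrite /K; field; exact: lt0r_neq0.
have := mulr_ge0 B0 C_ge0; lra.
Qed.

End moment_approximation.

(** * Measures from positive functionals *)

Section probability_of_distribution_function.
Context {R : realType} (F : R -> R) (F_nd : {homo F : x y / x <= y})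
  (F_rc : right_continuous F) (F_Ny : F x @[x --> -oo] --> (0 : R))
  (F_y : F x @[x --> +oo] --> (1 : R)).

HB.instance Definition _ := isCumulative.Build R _ R F F_nd F_rc.
HB.instance Definition _ := isCumulativeBounded.Build R 0 1 F F_Ny F_y.

Let lsF := lebesgue_stieltjes_measure (F : cumulativeBounded 0 1).

Definition distribution_measure : set R -> \bar R := lsF.

Let distribution_measure0 : distribution_measure set0 = 0%E.
Proof. exact: (measure0 lsF). Qed.

Let distribution_measure_ge0 A : (0 <= distribution_measure A)%E.
Proof. exact: (measure_ge0 lsF). Qed.

Let distribution_measure_sigma_additive : semi_sigma_additive distribution_measure.
Proof. exact: (@measure_semi_sigma_additive _ _ _ lsF). Qed.

HB.instance Definition _ := isMeasure.Build _ R R distribution_measure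
  distribution_measure0 distribution_measure_ge0 distribution_measure_sigma_additive.

Let distribution_measureT : distribution_measure setT = 1%E.
Proof. exact: (@probability_setT _ _ _ lsF). Qed.

HB.instance Definition _ := Measure_isProbability.Build _ R R distribution_measure
  distribution_measureT.

Lemma probability_of_distribution_function :
  exists mu : probability R R, forall x, mu `]-oo, x]%classic = (F x)%:E.
Proof.
exists (distribution_measure : probability R R) => x.
exact: (@cdf_lebesgue_stieltjes_id R F x).
Qed.

End probability_of_distribution_function.

Section clamp.
Context {R : realType}.
Implicit Types t y : R.

(* the projection of [t] to [0, 1] *)
Definition clamp t : R := (`|t| - `|t - 1| + 1) / 2.

Lemma clamp_eq0 t : t <= 0 -> clamp t = 0.
Proof.
move=> t0; rewrite /clamp ler0_norm// ler0_norm; last by lra.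
by lra.
Qed.

Lemma clamp_eq1 t : 1 <= t -> clamp t = 1.
Proof.
move=> t1; rewrite /clamp ger0_norm; last by lra.
by rewrite ger0_norm; lra.
Qed.

Lemma clamp_id t : 0 <= t <= 1 -> clamp t = t.
Proof.
move=> /andP[t0 t1]; rewrite /clamp ger0_norm// ler0_norm; last by lra.
by lra.
Qed.

Lemma clamp_ge0 t : 0 <= clamp t.
Proof.
have [t0|t0] := leP t 0; first by rewrite clamp_eq0.
have [t1|t1] := leP 1 t; first by rewrite clamp_eq1.
by rewrite clamp_id ?ltW.
Qed.

Lemma clamp_le1 t : clamp t <= 1.
Proof.
have [t0|t0] := leP t 0; first by rewrite clamp_eq0.
have [t1|t1] := leP 1 t; first by rewrite clamp_eq1.
by rewrite clamp_id ?ltW.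
Qed.

Lemma continuous_clamp : continuous clamp.
Proof.
move=> t; apply: cvgM; last exact: cvg_cst.
apply: cvgD; last exact: cvg_cst.
apply: cvgB; first exact: norm_continuous.
apply: (cvg_comp (fun t => t - 1) (fun t => `|t|)); last exact: norm_continuous.
by apply: cvgB; [exact: cvg_id|exact: cvg_cst].
Qed.

Lemma sum_clamp N y : 0 <= y <= N%:R -> \sum_(l < N) clamp (y - l%:R) = y.
Proof.
elim: N y => [|N IH] y /andP[y0 yN]; first by rewrite big_ord0; lra.
rewrite big_ord_recr /=; have [yN'|Ny] := leP y N%:R.
  by rewrite IH ?y0// clamp_eq0 ?addr0// subr_le0.
rewrite (eq_bigr (fun=> 1)); last first.
  move=> l _; rewrite clamp_eq1//.
  have : l.+1%:R <= N%:R :> R by rewrite ler_nat.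
  by rewrite -natr1; lra.
rewrite sumr_const card_ord clamp_id; first by lra.
by move: yN; rewrite -natr1 => yN; apply/andP; split; lra.
Qed.

End clamp.

Section bounded_continuous.
Context {R : realType}.
Implicit Types f g : R -> R.

Definition bounded_continuous f := continuous f /\ exists B, forall x, `|f x| <= B.

Lemma bounded_continuous_cst k : bounded_continuous (fun=> k).
Proof. by split; [move=> x; exact: cvg_cst|exists `|k|]. Qed.

Lemma bounded_continuousD f g : bounded_continuous f -> bounded_continuous g ->
  bounded_continuous (fun x => f x + g x).
Proof.
move=> [cf [B fB]] [cg [B' gB]]; split; first by move=> x; apply: cvgD; [exact: cf|exact: cg].
by exists (B + B') => x; rewrite (le_trans (ler_normD _ _))// lerD.
Qed.

Lemma bounded_continuousM f g : bounded_continuous f -> bounded_continuous g ->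
  bounded_continuous (fun x => f x * g x).
Proof.
move=> [cf [B fB]] [cg [B' gB]]; split; first by move=> x; apply: cvgM; [exact: cf|exact: cg].
by exists (B * B') => x; rewrite normrM ler_pM.
Qed.

Lemma bounded_continuousZ k f : bounded_continuous f ->
  bounded_continuous (fun x => k * f x).
Proof. by move=> bf; apply: bounded_continuousM => //; exact: bounded_continuous_cst. Qed.

Lemma bounded_continuous_clamp f : continuous f ->
  bounded_continuous (fun x => clamp (f x)).
Proof.
move=> cf; split.
  move=> x; apply: (cvg_comp f clamp); [exact: cf|exact: continuous_clamp].
by exists 1 => x; rewrite ger0_norm ?clamp_ge0 ?clamp_le1.
Qed.

Lemma bounded_continuous_sum n (F : 'I_n -> R -> R) :
  (forall i, bounded_continuous (F i)) -> bounded_continuous (fun x => \sum_i F i x).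
Proof.
elim: n F => [|n IH] F bF.
  rewrite (_ : (fun x => _) = fun=> 0); first exact: bounded_continuous_cst.
  by apply/funext => x; rewrite big_ord0.
rewrite (_ : (fun x => _) = fun x => F ord0 x + \sum_i F (lift ord0 i) x).
  by apply: bounded_continuousD => //; apply: IH => i.
by apply/funext => x; rewrite big_ord_recl.
Qed.

Lemma bounded_continuous_integrable (mu : probability R R) f :
  bounded_continuous f -> mu.-integrable setT (EFin \o f).
Proof.
move=> [cf [B fB]]; apply: measurable_bounded_integrable => //.
- by rewrite (@le_lt_trans _ _ 1%E) ?probability_le1// ltry.
- exact: continuous_measurable_fun.
- exists B; split; first by rewrite num_real.
  by move=> x Bx y _ /=; rewrite (le_trans (fB y))// ltW.
Qed.

End bounded_continuous.

(** * Representation of a tight positive functional on decreasing functions *)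

Section riesz.
Context {R : realType} (L : (R -> R) -> R) (C : R).
Implicit Types f g : R -> R.
Context (L_cst : forall k, L (fun=> k) = k)
  (L_D : forall f g, bounded_continuous f -> bounded_continuous g ->
     L (fun x => f x + g x) = L f + L g)
  (L_Z : forall k f, bounded_continuous f -> L (fun x => k * f x) = k * L f)
  (L_le : forall f g, bounded_continuous f -> bounded_continuous g ->
     (forall x, 0 <= x -> f x <= g x) -> L f <= L g)
  (L_tail : forall t g, 0 < t -> bounded_continuous g ->
     (forall x, 0 <= x -> 1 - x / t <= g x) -> 1 - C / t <= L g).

Definition majorant (x : R) : set (R -> R) :=
  [set g | [/\ bounded_continuous g, forall y, 0 <= g y & forall y, y <= x -> 1 <= g y]].

(** The infimum over continuous majorants of the indicator of the lower half-line approximates it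
    from outside, which makes the function right continuous. *)
Definition riesz_cdf (x : R) : R := inf (L @` majorant x).
Local Notation F := riesz_cdf.

Lemma majorant_cst1 x : majorant x (fun=> 1).
Proof. by split => //; exact: bounded_continuous_cst. Qed.

Lemma L_ge0 g : bounded_continuous g -> (forall y, 0 <= y -> 0 <= g y) -> 0 <= L g.
Proof.
by move=> bg g0; rewrite -(L_cst 0); apply: L_le => //; exact: bounded_continuous_cst.
Qed.

Lemma riesz_cdf_le x g : majorant x g -> F x <= L g.
Proof.
move=> mg; apply: ge_inf; last by exists g.
by exists 0 => _ [h [bh h0 _] <-]; apply: L_ge0.
Qed.

Lemma riesz_cdf_ge x b : (forall g, majorant x g -> b <= L g) -> b <= F x.
Proof.
move=> H; apply: lb_le_inf; first by exists (L (fun=> 1)), (fun=> 1) => //; exact: majorant_cst1.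
by move=> _ [g mg <-]; exact: H.
Qed.

Lemma riesz_cdf_nd : {homo F : x y / x <= y}.
Proof.
move=> x y xy; apply: riesz_cdf_ge => g [bg g0 g1].
by apply: riesz_cdf_le; split => // z zx; apply: g1; exact: le_trans xy.
Qed.

Lemma riesz_cdf_ge0 x : 0 <= F x.
Proof. by apply: riesz_cdf_ge => g [bg g0 _]; apply: L_ge0. Qed.

Lemma riesz_cdf_le1 x : F x <= 1.
Proof. by rewrite -[leRHS](L_cst 1); apply: riesz_cdf_le; exact: majorant_cst1. Qed.

Lemma riesz_cdf_rc : right_continuous F.
Proof.
move=> x; apply/cvgrPdist_le => e e0.
have e20 : 0 < e / 2 by rewrite divr_gt0.
have hinf : has_inf (L @` majorant x).
  split; first by exists (L (fun=> 1)), (fun=> 1) => //; exact: majorant_cst1.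
  by exists 0 => _ [h [bh h0 _] <-]; apply: L_ge0.
have [_ [g [bg g0 g1] <-] Lg] := inf_adherent e20 hinf.
have /cvgrPdist_lt/(_ _ e20) := bg.1 x; move=> [d /= d0 gd].
near=> y.
have xy : x < y by near: y; exact: nbhs_right_gt.
have yd : y < x + d by near: y; apply: nbhs_right_lt; rewrite ltrDl.
have Fxy : F x <= F y by apply: riesz_cdf_nd; exact: ltW.
rewrite distrC ger0_norm ?subr_ge0//.
(* By continuity at [x], a near-optimal majorant at [x] raised by [e / 2] is still a majorant
   slightly to the right of [x]. *)
have : F y <= L (fun z => g z + e / 2).
  apply: riesz_cdf_le; split.
  - by apply: bounded_continuousD => //; exact: bounded_continuous_cst.
  - by move=> z; rewrite addr_ge0// ltW.
  - move=> z zy; have [zx|xz] := leP z x; first by have := g1 z zx; lra.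
    have xzd : `|x - z| < d by rewrite distrC gtr0_norm ?subr_gt0//; lra.
    have := gd z xzd; have := g1 x (lexx x); have := ler_norm (g x - g z); lra.
rewrite L_D// ?L_cst; last exact: bounded_continuous_cst.
by move: Lg; rewrite -/(F x); lra.
Unshelve. all: by end_near. Qed.

(** The majorant [clamp (y / x)] vanishes on the half-line, which is all that [L] sees. *)
Lemma riesz_cdf_lt0 x : x < 0 -> F x = 0.
Proof.
move=> x0; apply/eqP; rewrite eq_le riesz_cdf_ge0 andbT.
have bg : bounded_continuous (fun y => clamp (y * x^-1)).
  apply: bounded_continuous_clamp => y.
  by apply: cvgM; [exact: cvg_id|exact: cvg_cst].
apply: (@le_trans _ _ (L (fun y => clamp (y * x^-1)))).
  apply: riesz_cdf_le; split => // [y|y yx]; first exact: clamp_ge0.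
  by rewrite clamp_eq1// ler_ndivlMr// mul1r.
rewrite -[leRHS](L_cst 0); apply: L_le => //; first exact: bounded_continuous_cst.
by move=> y y0; rewrite clamp_eq0// mulr_ge0_le0// invr_le0 ltW.
Qed.

(** Markov's inequality. As [1 - x / t] is unbounded below, it enters only through its bounded
    majorants, and every member of [majorant t] is one on the half-line. *)
Lemma riesz_cdf_tail t : 0 < t -> 1 - C / t <= F t.
Proof.
move=> t0; apply: riesz_cdf_ge => g [bg g0 g1]; apply: L_tail => // x x0.
have [xt|tx] := leP x t.
  by apply: le_trans (g1 x xt); rewrite gerBl divr_ge0// ltW.
apply: le_trans (g0 x); rewrite subr_le0 ler_pdivlMr// mul1r ltW//.
Qed.

Lemma riesz_cdf_Ny : F x @[x --> -oo] --> (0 : R).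
Proof.
apply: cvg_near_cst; near=> x; apply: riesz_cdf_lt0.
by near: x; exact: nbhs_ninfty_lt.
Unshelve. all: by end_near. Qed.

Lemma riesz_cdf_y : F x @[x --> +oo] --> (1 : R).
Proof.
apply/cvgrPdist_le => e e0; near=> x.
have x0 : 0 < x by near: x; apply: nbhs_pinfty_gt; rewrite num_real.
have Cx : `|C| / e < x by near: x; apply: nbhs_pinfty_gt; rewrite num_real.
rewrite ger0_norm ?subr_ge0 ?riesz_cdf_le1//.
have := riesz_cdf_tail x0; suff : C / x <= e by lra.
rewrite ler_pdivrMr// mulrC; move: Cx; rewrite ltr_pdivrMr// => /ltW.
by apply: le_trans; exact: ler_norm.
Unshelve. all: by end_near. Qed.

Lemma L_sum n (G : 'I_n -> R -> R) : (forall i, bounded_continuous (G i)) ->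
  L (fun x => \sum_i G i x) = \sum_i L (G i).
Proof.
elim: n G => [|n IH] G bG.
  by rewrite big_ord0 -[RHS](L_cst 0); congr L; apply/funext => x; rewrite big_ord0.
rewrite big_ord_recl -IH// -L_D//; last exact: bounded_continuous_sum.
by congr L; apply/funext => x; rewrite big_ord_recl.
Qed.

Context (mu : probability R R) (mu_F : forall x, mu `]-oo, x]%classic = (F x)%:E).

Lemma Rintegral_sum n (G : 'I_n -> R -> R) : (forall i, bounded_continuous (G i)) ->
  \int[mu]_x (\sum_i G i x) = \sum_i \int[mu]_x G i x.
Proof.
elim: n G => [|n IH] G bG.
  rewrite big_ord0; under eq_Rintegral do rewrite big_ord0.
  by rewrite Rintegral_cst// mul0r.
rewrite big_ord_recl -IH// -RintegralD//.
- by apply: eq_Rintegral => x _; rewrite big_ord_recl.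
- exact: bounded_continuous_integrable.
- by apply: bounded_continuous_integrable; exact: bounded_continuous_sum.
Qed.

Lemma Rintegral_indic_below x : \int[mu]_y (\1_(`]-oo, x]%classic) y) = F x.
Proof. by rewrite /Rintegral integral_indic// setIT; exact: (congr1 fine (mu_F x)). Qed.

Lemma integrable_indic_below x : mu.-integrable setT (EFin \o \1_(`]-oo, x]%classic)).
Proof.
apply: integrable_indic => //.
Qed.

Context (f : R -> R) (bf : bounded_continuous f) (f_ni : forall x y, x <= y -> f y <= f x)
  (f_le0 : forall x, x <= 0 -> f x = 1) (f_ge0 : forall x, 0 <= f x)
  (f_lim0 : forall e : R, 0 < e -> exists x, f x < e).

Lemma layer_point N l : (0 < l <= N)%N -> exists x, f x = l%:R / N%:R.
Proof.
move=> /andP[l0 lN]; have N0 : (0 < N)%N by exact: leq_trans lN.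
have v0 : 0 < l%:R / N%:R :> R by rewrite divr_gt0 ?ltr0n.
have v1 : l%:R / N%:R <= 1 :> R by rewrite ler_pdivrMr ?ltr0n// mul1r ler_nat.
have [x fx] := f_lim0 v0.
have x0 : 0 <= x.
  by rewrite leNgt; apply/negP => /ltW /f_le0 fx1; move: fx; rewrite fx1 ltNge v1.
have [||c _ fc] := @IVT _ f 0 x (l%:R / N%:R) x0; last by exists c.
  exact/continuous_subspaceT/bf.1.
rewrite f_le0// minEle maxEle.
have -> : (1 <= f x) = false by apply/negbTE; rewrite -ltNge (lt_le_trans fx).
by rewrite v1 ltW.
Qed.

(* [N f] is a sum of [N] layers [psi_l] whose values under [L] and under [mu] both
   lie between [F (X l.+1)] and [F (X l)]; these bounds telescope. *)
Lemma layer_cake_bound N : (0 < N)%N -> `|L f - \int[mu]_x f x| <= N%:R^-1.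
Proof.
move=> N0; have NR : 0 < N%:R :> R by rewrite ltr0n.
have /choice[X XP] : forall l, exists x, (0 < l <= N)%N -> f x = l%:R / N%:R.
  move=> l; have [lN|] := boolP (0 < l <= N)%N; last by exists 0.
  by have [x fx] := layer_point lN; exists x.
pose psi (l : nat) x := clamp (N%:R * f x - l%:R).
have bpsi l : bounded_continuous (psi l).
  apply: bounded_continuous_clamp => x; apply: cvgB; last exact: cvg_cst.
  by apply: cvgM; [exact: cvg_cst|exact: bf.1].
(* The level 0 may never be attained by [f], so the upper bound for the lowest layer is 1 instead of
   a value of [F]. *)
pose G l := if l is 0%N then 1 else F (X l).
have psi1 l x : (l < N)%N -> x <= X l.+1 -> psi l x = 1.
  move=> lN xX; rewrite /psi clamp_eq1//.
  have := f_ni xX; rewrite XP ?ltnS// ler_pdivrMr// mulrC -natr1; lra.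
have psi0 l x : (0 < l < N)%N -> X l <= x -> psi l x = 0.
  move=> /andP[l0 lN] Xx; rewrite /psi clamp_eq0//.
  have := f_ni Xx; rewrite XP ?l0 1?ltnW// ler_pdivlMr// mulrC; lra.
have sumpsi x : N%:R * f x = \sum_(l < N) psi l x.
  rewrite sum_clamp// mulr_ge0//= -[leRHS]mulr1 ler_wpM2l//.
  have [x0|x0] := leP x 0; first by rewrite f_le0.
  by rewrite -(f_le0 (lexx 0)) f_ni// ltW.
have Lpsi l : (l < N)%N -> G l.+1 <= L (psi l) <= G l.
  move=> lN; apply/andP; split.
    by apply: riesz_cdf_le; split => // [y|y /psi1 ->//]; exact: clamp_ge0.
  case: l lN => [|l] lN.
    rewrite -[leRHS](L_cst 1); apply: L_le => //; first exact: bounded_continuous_cst.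
    by move=> x _; exact: clamp_le1.
  apply: riesz_cdf_ge => g [bg g0 g1]; apply: L_le => // x _.
  have [xX|Xx] := leP x (X l.+1); first by apply: le_trans (clamp_le1 _) (g1 _ xX).
  by rewrite psi0// ltW.
have Ipsi l : (l < N)%N -> G l.+1 <= \int[mu]_x psi l x <= G l.
  move=> lN; have ipsi := bounded_continuous_integrable mu (bpsi l).
  apply/andP; split.
    rewrite /G -Rintegral_indic_below; apply: le_Rintegral => //.
      exact: integrable_indic_below.
    move=> x _; rewrite indicE; case: (boolP (x \in _)) => [|_]; last exact: clamp_ge0.
    by rewrite inE/= in_itv/= => /psi1 ->.
  case: l lN ipsi => [|l] lN ipsi.
    rewrite [leRHS](_ : _ = \int[mu]_x (cst 1) x); last first.
      rewrite Rintegral_cst// mul1r; exact: (esym (congr1 fine (probability_setT mu))).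
    apply: le_Rintegral => //; last by move=> x _; exact: clamp_le1.
    by apply: bounded_continuous_integrable; exact: bounded_continuous_cst.
  rewrite /G -Rintegral_indic_below; apply: le_Rintegral => //.
    exact: integrable_indic_below.
  move=> x _; rewrite indicE; case: (boolP (x \in _)) => [_|]; first exact: clamp_le1.
  by rewrite notin_setE/= in_itv/= => /negP; rewrite -ltNge => /ltW /psi0 ->.
have LE : N%:R * L f = \sum_(l < N) L (psi l).
  rewrite -L_Z// -L_sum//; congr L; exact/funext.
have IE : N%:R * \int[mu]_x f x = \sum_(l < N) \int[mu]_x psi l x.
  rewrite -RintegralZl//; last exact: bounded_continuous_integrable.
  by rewrite -Rintegral_sum//; apply: eq_Rintegral => x _.
rewrite -(ler_pM2l NR) mulfV ?gt_eqF// -{1}(gtr0_norm NR) -normrM mulrBr LE IE -sumrB.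
apply: le_trans (ler_norm_sum _ _ _) _.
apply: (@le_trans _ _ (\sum_(l < N) (G l - G l.+1))).
  apply: ler_sum => l _; have := Lpsi l (ltn_ord l); have := Ipsi l (ltn_ord l).
  by move=> /andP[h1 h2] /andP[h3 h4]; rewrite ler_norml; apply/andP; split; lra.
have -> : \sum_(l < N) (G l - G l.+1) = G 0%N - G N.
  elim: (N) => [|k IH]; first by rewrite big_ord0 subrr.
  by rewrite big_ord_recr IH /= addrA subrK.
rewrite lerBlDr lerDl; case: (N) N0 => // k _; exact: riesz_cdf_ge0.
Qed.

Lemma layer_cake : L f = \int[mu]_x f x.
Proof.
apply/eqP; rewrite -subr_eq0 -normr_le0; apply/ler_addgt0Pr => e e0; rewrite add0r.
have e1 : 0 <= e^-1 by rewrite invr_ge0 ltW.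
have := archi_boundP e1; set N := Num.bound _ => eN.
have N0 : (0 < N)%N by rewrite -(ltr0n R); exact: le_lt_trans eN.
apply: le_trans (layer_cake_bound N0) _.
by rewrite -[leRHS]invrK lef_pV2 ?posrE ?invr_gt0 ?ltr0n// ltW.
Qed.

End riesz.

Lemma cvg_sumr {R : realType} (I : Type) (r : seq I) (Q : pred I) (f : I -> nat -> R)
    (l : I -> R) : (forall i, Q i -> f i n @[n --> \oo] --> l i) ->
  \sum_(i <- r | Q i) f i n @[n --> \oo] --> \sum_(i <- r | Q i) l i.
Proof. by move=> fl; apply: cvg_big => //; exact: add_continuous. Qed.

Lemma limn_near_eq {R : realType} (u v : nat -> R) (l : R) :
  u n @[n --> \oo] --> l -> (\forall n \near \oo, u n = v n) -> limn v = l.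
Proof.
move=> ul uv; apply/cvg_lim => //.
by apply: cvg_trans ul; exact: near_eq_cvg.
Qed.

Section positive_functionals.
Context {R : realType}.
Implicit Types (f g : R -> R) (p q : {poly R}).

(** Monotonicity for comparisons on the half-line only encodes the support. Linearity holds for
    arbitrary functions, as suits finite spectral sums. *)
Record positive_functional (Lam : (R -> R) -> R) : Prop := PositiveFunctional {
  pfD : forall f g, Lam (fun x => f x + g x) = Lam f + Lam g;
  pfZ : forall k f, Lam (fun x => k * f x) = k * Lam f;
  pf_le : forall f g, (forall x, 0 <= x -> f x <= g x) -> Lam f <= Lam g }.

Lemma pf_poly Lam p : positive_functional Lam ->
  Lam (fun x => p.[x]) = \sum_(i < size p) p`_i * Lam (fun x => x ^+ i).
Proof.
move=> pfL.
have H n (F : 'I_n -> R -> R) : Lam (fun x => \sum_i F i x) = \sum_i Lam (F i).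
  elim: n F => [|n IH] F.
    rewrite big_ord0 -[RHS](mul0r (Lam (fun=> 0))) -(pfZ pfL); congr Lam.
    by apply/funext => x; rewrite big_ord0 mul0r.
  rewrite big_ord_recl -IH -(pfD pfL); congr Lam.
  by apply/funext => x; rewrite big_ord_recl.
transitivity (Lam (fun x => \sum_(i < size p) p`_i * x ^+ i)).
  by congr Lam; apply/funext => x; rewrite horner_coef.
by rewrite H; apply: eq_bigr => i _; rewrite (pfZ pfL).
Qed.

Context (M : nat -> R).

(* Positivity is only required eventually: for [n < c] the Bernoulli weights are
   not probabilities. *)
Definition moment_convergent (Lam : nat -> (R -> R) -> R) :=
  (\forall n \near \oo, positive_functional (Lam n)) /\
  forall k, Lam n (fun x => x ^+ k) @[n --> \oo] --> M k.

Lemma moment_convergent_poly Lam p : moment_convergent Lam ->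
  Lam n (fun x => p.[x]) @[n --> \oo] --> moment_functional M p.
Proof.
move=> [pL mL].
have H : \sum_(i < size p) p`_i * Lam n (fun x => x ^+ i) @[n --> \oo] -->
    moment_functional M p.
  by apply: cvg_sumr => i _; apply: cvgM => //; exact: cvg_cst.
by apply: cvg_trans H; apply: near_eq_cvg; near=> n; rewrite pf_poly//; near: n.
Unshelve. all: by end_near. Qed.

(** [Lam n f] is within [Lam n q <= 2 e] of [Lam n p], itself within [e] of its limit. The centre
    depends on [M] alone, which yields both the Cauchy property and the independence of the limit
    from [Lam]. *)
Lemma moment_convergent_near Lam f p q (e : R) : moment_convergent Lam -> 0 < e ->
  (forall x, 0 <= x -> `|f x - p.[x]| <= q.[x]) -> moment_functional M q <= e ->
  \forall n \near \oo, `|moment_functional M p - Lam n f| <= 3 * e.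
Proof.
move=> mL e0 fpq qe.
have /cvgrPdist_le/(_ _ e0) hp := moment_convergent_poly (p := p) mL.
have /cvgrPdist_le/(_ _ e0) hq := moment_convergent_poly (p := q) mL.
near=> n.
have pfL : positive_functional (Lam n) by near: n; exact: mL.1.
have hpn : `|moment_functional M p - Lam n (fun x => p.[x])| <= e by near: n.
have hqn : `|moment_functional M q - Lam n (fun x => q.[x])| <= e by near: n.
have q2 : Lam n (fun x => q.[x]) <= 2 * e.
  by move: hqn; rewrite ler_norml => /andP[]; lra.
have up : Lam n f <= Lam n (fun x => p.[x]) + Lam n (fun x => q.[x]).
  rewrite -(pfD pfL); apply: (pf_le pfL) => x x0.
  by have := fpq x x0; rewrite ler_norml => /andP[]; lra.
have dn : Lam n (fun x => p.[x]) <= Lam n f + Lam n (fun x => q.[x]).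
  rewrite -(pfD pfL); apply: (pf_le pfL) => x x0.
  by have := fpq x x0; rewrite ler_norml => /andP[]; lra.
by move: hpn; rewrite !ler_norml => /andP[h1 h2]; apply/andP; split; lra.
Unshelve. all: by end_near. Qed.

Lemma moment_convergent_is_cvg Lam f : moment_convergent Lam -> moment_approx M f ->
  cvgn (fun n => Lam n f).
Proof.
move=> mL af; apply/cauchy_cvgP/cauchy_exP => e e0.
have e4 : 0 < e / 4 by rewrite divr_gt0.
have [p [q [fpq qe]]] := af _ e4.
exists (moment_functional M p).
have := moment_convergent_near mL e4 fpq qe; apply: filterS => n h.
by rewrite /ball /=; lra.
Qed.

Lemma moment_convergent_same_lim Lam Lam' f (l : R) : moment_convergent Lam ->
  moment_convergent Lam' -> moment_approx M f ->
  Lam n f @[n --> \oo] --> l -> Lam' n f @[n --> \oo] --> l.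
Proof.
move=> mL mL' af fl; apply/cvgrPdist_le => e e0.
have e8 : 0 < e / 8 by rewrite divr_gt0.
have [p [q [fpq qe]]] := af _ e8.
have h := moment_convergent_near mL e8 fpq qe.
have h' := moment_convergent_near mL' e8 fpq qe.
have lp : `|moment_functional M p - l| <= 3 * (e / 8).
  have : `|moment_functional M p - Lam n f| @[n --> \oo] --> `|moment_functional M p - l|.
    by apply: cvg_norm; apply: cvgB => //; exact: cvg_cst.
  by move/cvgr_to_le; apply.
near=> n.
apply: le_trans (ler_distD (moment_functional M p) _ _) _.
have : `|moment_functional M p - Lam' n f| <= 3 * (e / 8) by near: n.
by rewrite (distrC l); lra.
Unshelve. all: by end_near. Qed.

Context (M0 : M 0%N = 1) (C : R) (C_ge0 : 0 <= C)
  (M_growth : forall k, `|M k| <= C ^+ k * (k.*2)`!%:R).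

Lemma limit_measure_exists Lam : moment_convergent Lam ->
  exists mu : probability R R, [/\ (forall x, x < 0 -> mu `]-oo, x]%classic = 0%E),
    (forall t, 0 < t -> ((1 - M 1%N / t)%:E <= mu `]-oo, t]%classic)%E) &
  forall f, bounded_continuous f -> (forall x y, x <= y -> f y <= f x) ->
    (forall x, x <= 0 -> f x = 1) -> (forall x, 0 <= f x) ->
    (forall e : R, 0 < e -> exists x, f x < e) ->
    Lam n f @[n --> \oo] --> \int[mu]_x f x].
Proof.
(* [limn] is total; it is a genuine limit on bounded continuous functions by [LP], and the laws of
   [L] are proved there. *)
move=> mL; pose L f := limn (fun n => Lam n f).
have LP f : bounded_continuous f -> Lam n f @[n --> \oo] --> L f.
  move=> [cf [B fB]]; apply: (moment_convergent_is_cvg mL).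
  exact: (moment_approx_bounded_continuous C_ge0 M_growth cf fB).
have near_pf := mL.1.
have L_cst k : L (fun=> k) = k.
  have h : k * Lam n (fun x => x ^+ 0) @[n --> \oo] --> k * M 0%N.
    by apply: cvgM; [exact: cvg_cst|exact: mL.2].
  rewrite M0 mulr1 in h; apply: (limn_near_eq h); near=> n.
  have pfL : positive_functional (Lam n) by near: n.
  by rewrite -(pfZ pfL); congr (Lam n); apply/funext => x; rewrite expr0 mulr1.
have L_D f g : bounded_continuous f -> bounded_continuous g ->
    L (fun x => f x + g x) = L f + L g.
  move=> bf bg; apply: (limn_near_eq (cvgD (LP f bf) (LP g bg))); near=> n.
  have pfL : positive_functional (Lam n) by near: n.
  by rewrite (pfD pfL).
have L_Z k f : bounded_continuous f -> L (fun x => k * f x) = k * L f.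
  move=> bf.
  have h : k * Lam n f @[n --> \oo] --> k * L f by apply: cvgM; [exact: cvg_cst|exact: LP].
  apply: (limn_near_eq h); near=> n.
  have pfL : positive_functional (Lam n) by near: n.
  by rewrite (pfZ pfL).
have L_le f g : bounded_continuous f -> bounded_continuous g ->
    (forall x, 0 <= x -> f x <= g x) -> L f <= L g.
  move=> bf bg fg; apply: ler_lim; [exact: cvgP (LP f bf)|exact: cvgP (LP g bg)|].
  near=> n; have pfL : positive_functional (Lam n) by near: n.
  exact: (pf_le pfL).
have L_tail t g : 0 < t -> bounded_continuous g ->
    (forall x, 0 <= x -> 1 - x / t <= g x) -> 1 - M 1%N / t <= L g.
  move=> t0 bg g1.
  have h : Lam n (fun x => x ^+ 0) + - t^-1 * Lam n (fun x => x ^+ 1) @[n --> \oo] -->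
      M 0%N + - t^-1 * M 1%N.
    by apply: cvgD; [exact: mL.2|apply: cvgM; [exact: cvg_cst|exact: mL.2]].
  rewrite (_ : 1 - M 1%N / t = M 0%N + - t^-1 * M 1%N); last by rewrite M0 mulNr mulrC.
  rewrite -(cvg_lim _ h)//; apply: ler_lim; [exact: cvgP h|exact: cvgP (LP g bg)|].
  near=> n; have pfL : positive_functional (Lam n) by near: n.
  rewrite -(pfZ pfL) -(pfD pfL); apply: (pf_le pfL) => x x0.
  by rewrite expr0 expr1 mulNr mulrC; exact: g1.
have nd := riesz_cdf_nd L_cst L_le.
have rc := riesz_cdf_rc L_cst L_D L_le.
have Ny := riesz_cdf_Ny L_cst L_le.
have y := riesz_cdf_y L_cst L_le L_tail.
have [mu muF] := probability_of_distribution_function nd rc Ny y.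
exists mu; split => [x x0|t t0|f bf f_ni f_le0 f_ge0 f_lim0].
- by rewrite muF (riesz_cdf_lt0 L_cst L_le x0).
- by rewrite muF lee_fin; exact: riesz_cdf_tail.
rewrite -(layer_cake L_cst L_D L_Z L_le muF bf f_ni f_le0 f_ge0 f_lim0).
exact: LP.
Unshelve. all: by end_near. Qed.

End positive_functionals.

(** * Convergence of the mean spectral measure *)

Section gram_spectrum.
Context {R : realType} {n m : nat} (c : R) (c0 : 0 < c).
Implicit Types (A : 'M[R]_(n, m)) (f g : R -> R).

Definition spectral_mean (W : 'M[R]_n) f : R := n%:R^-1 * \sum_(x <- spectrum W) f x.

Lemma psd_scaled_gram A : psd (scaled_gram c A).
Proof. by apply: psd_gram; rewrite invr_ge0 ltW. Qed.

Lemma spectral_meanE A f : spectral_mean (scaled_gram c A) f =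
  n%:R^-1 * \sum_i f (eigenvalues (scaled_gram c A) 0 i).
Proof. by rewrite /spectral_mean (sum_spectrum (psd_scaled_gram A).1). Qed.

Lemma spectral_mean_pf A : positive_functional (spectral_mean (scaled_gram c A)).
Proof.
split=> [f g|k f|f g fg]; rewrite !spectral_meanE.
- by rewrite -mulrDr -big_split.
- by rewrite -mulr_sumr mulrCA.
- rewrite ler_wpM2l ?invr_ge0//; apply: ler_sum => i _; apply: fg.
  have pW := psd_scaled_gram A; exact: (eigenvalues_ge0 pW.1 pW).
Qed.

Lemma spectral_mean_expr A k :
  spectral_mean (scaled_gram c A) (fun x => x ^+ k) = n%:R^-1 * \tr (scaled_gram c A ^+ k).
Proof. by rewrite spectral_meanE (trace_powers (psd_scaled_gram A).1). Qed.

Lemma scalemxX (k : R) (W : 'M[R]_n) j : (k *: W) ^+ j = k ^+ j *: W ^+ j.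
Proof.
elim: j => [|j IH]; first by rewrite !expr0 scale1r.
rewrite !exprS IH; have -> : (k *: W) * (k ^+ j *: W ^+ j) = (k *: W) *m (k ^+ j *: W ^+ j) by [].
by rewrite -scalemxAl -scalemxAr scalerA.
Qed.

Lemma trace_scaled_gramX A k :
  \tr (scaled_gram c A ^+ k) = c^-1 ^+ k * \tr ((A *m A^T) ^+ k).
Proof. by rewrite /scaled_gram scalemxX mxtraceZ. Qed.

End gram_spectrum.

Section mean_functional.
Context {R : realType} (c : R) (c0 : 0 < c).

(** The configurations are functions from columns to boolean vectors, so that a coordinate of the
    product space is a whole column. *)
Definition mean_functional (n m : nat) (f : R -> R) : R :=
  prodE (column_weight (c / n%:R)) (fun a : {ffun 'I_m -> {ffun 'I_n -> bool}} =>
    spectral_mean (scaled_gram c (bool_mx a)) f).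

Lemma density_itv n : (0 < n)%N -> c <= n%:R -> 0 <= c / n%:R <= 1.
Proof.
by move=> n0 cn; rewrite divr_ge0 ?(ltW c0)//= ler_pdivrMr ?ltr0n// mul1r.
Qed.

Lemma mean_functional_pf n m : (0 < n)%N -> c <= n%:R ->
  positive_functional (mean_functional n m).
Proof.
move=> n0 cn; have p01 := density_itv n0 cn.
have pf a := @spectral_mean_pf R n m c c0 (bool_mx a).
split=> [f g|k f|f g fg]; rewrite /mean_functional.
- by rewrite -prodED; apply: eq_prodE => a; rewrite (pfD (pf a)).
- by rewrite -prodEZ; apply: eq_prodE => a; rewrite (pfZ (pf a)).
- apply: le_prodE => [v|a]; first exact: column_weight_ge0.
  exact: (pf_le (pf a)).
Qed.

Context (alpha : R) (alpha_gt0 : 0 < alpha) (m : nat -> nat) (m_alpha : (m n)%:R / n%:R @[n --> \oo] --> alpha).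

Lemma mean_functional_moments :
  moment_convergent (limit_moment alpha c) (fun n => mean_functional n (m n)).
Proof.
split.
  near=> n; apply: mean_functional_pf; first by near: n; exists 1%N.
  by near: n; exact: nbhs_infty_ger.
case=> [|k].
  (* The moment of order 0 is [n / n], which is 1 only for positive [n]. *)
  have h := @cvg_natdiv R; apply: cvg_trans h; apply: near_eq_cvg; near=> n.
  rewrite /mean_functional -[LHS](@prodE_cst _ 'I_(m n) _ _ (@column_weight_sum1 R n (c / n%:R))).
  apply: eq_prodE => a; rewrite spectral_mean_expr// expr0 mxtrace1 mulrC//.
have -> : (fun n => mean_functional n (m n) (fun x => x ^+ k.+1)) = fun n =>
    c^-1 ^+ k.+1 * \sum_(r : {ffun 'I_k.+1 -> 'I_k.+1} | ker r == r)
      \sum_(s : {ffun 'I_k.+1 -> 'I_k.+1} | ker s == s) n%:R^-1 *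
      ((n ^_ #|[set r x | x : 'I_k.+1]%SET|)%:R * (m n ^_ #|[set s x | x : 'I_k.+1]%SET|)%:R *
      (c / n%:R) ^+ #|walk_edges r s|).
  apply/funext => n; rewrite /mean_functional.
  transitivity (c^-1 ^+ k.+1 * (n%:R^-1 * prodE (column_weight (c / n%:R))
     (fun a : {ffun 'I_(m n) -> {ffun 'I_n -> bool}} =>
        \tr ((bool_mx a *m (bool_mx a)^T : 'M[R]_n) ^+ k.+1)))).
    rewrite -!prodEZ; apply: eq_prodE => a.
    by rewrite spectral_mean_expr// trace_scaled_gramX mulrCA.
  rewrite prodE_trace; congr (_ * _); rewrite mulr_sumr; apply: eq_bigr => r _.
  by rewrite mulr_sumr.
rewrite /limit_moment; apply: cvgM; first exact: cvg_cst.
apply: cvg_sumr => r _; apply: cvg_sumr => s _.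
by apply: cvg_walk_term => //; exact: walk_graph_connected.
Unshelve. all: by end_near. Qed.

End mean_functional.

(** * Almost sure convergence *)

Section decay.
Context {R : realType}.
Implicit Types (x : R) (j : nat).

(* [(1 + max x 0) ^- j] *)
Definition decay j x : R := (1 + (x + `|x|) / 2)^-1 ^+ j.

Lemma decay_ge0E j x : 0 <= x -> decay j x = (1 + x)^-1 ^+ j.
Proof. by move=> x0; rewrite /decay ger0_norm//; congr (_^-1 ^+ _); lra. Qed.

End decay.

Section decay_mean.
Context {R : realType} {n m : nat} (c : R) (c0 : 0 < c).
Implicit Types (A B : 'M[R]_(n, m)) (j : nat).

Local Notation sm A j := (spectral_mean (scaled_gram c A) (decay j)).

Lemma spectral_mean_decay A j :
  sm A j = n%:R^-1 * \tr (resolvent (scaled_gram c A) ^+ j).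
Proof.
have pW := psd_scaled_gram c0 A.
rewrite (spectral_meanE c0) (trace_resolvent_powers pW.1 pW); congr (_ * _).
apply: eq_bigr => i _; rewrite decay_ge0E ?exprVn//.
exact: (eigenvalues_ge0 pW.1 pW).
Qed.

Let ci0 : 0 <= c^-1. Proof. by rewrite invr_ge0 ltW. Qed.

Lemma spectral_mean_decay_col A B (l : 'I_m) j : (forall i k, k != l -> A i k = B i k) ->
  `|sm A j - sm B j| <= n%:R^-1 * (2 * j%:R).
Proof.
move=> AB; rewrite !spectral_mean_decay -mulrBr normrM ger0_norm ?invr_ge0//.
by rewrite ler_wpM2l ?invr_ge0// (trace_gram_col ci0 j AB).
Qed.

Lemma spectral_mean_decay_shift A p j :
  `|sm (A - const_mx p) j - sm A j| <= n%:R^-1 * (2 * j%:R).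
Proof.
rewrite !spectral_mean_decay -mulrBr normrM ger0_norm ?invr_ge0//.
by rewrite ler_wpM2l ?invr_ge0// (trace_gram_shift ci0 A p j).
Qed.

Lemma spectral_mean_concentration j (e : R) : (0 < n)%N -> c <= n%:R -> 0 < e ->
  \sum_(a : {ffun 'I_m -> {ffun 'I_n -> bool}} |
     e < `|sm (bool_mx a) j - mean_functional c n m (decay j)|)
     \prod_l column_weight (c / n%:R) (a l)
  <= 4 * m%:R ^+ 2 * (n%:R^-1 * (2 * j%:R)) ^+ 4 / e ^+ 4.
Proof.
move=> n0 cn e0; have p01 := density_itv c0 n0 cn.
rewrite -[X in 4 * X%:R ^+ 2]card_ord.
apply: (concentration (fun v => column_weight_ge0 v p01) (column_weight_sum1 _)) => //.
move=> a l v; apply: (@spectral_mean_decay_col _ _ l) => i k kl.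
by rewrite !mxE ffunE (negPf kl).
Qed.

End decay_mean.

Section finite_model.
Context d (T : measurableType d) (R : realType) (P : probability T R).
Context (n m : nat) (p lo hi : R) (X : 'I_n -> 'I_m -> {RV P >-> R}).
Context (lohi : lo != hi) (iidX : iid_two_point_entries p lo hi X).

Let value (b : bool) := if b then hi else lo.

Let pattern_event (a : {ffun 'I_m -> {ffun 'I_n -> bool}}) : set T :=
  \bigcap_(ij in [set` [set: 'I_n * 'I_m]%SET]) X ij.1 ij.2 @^-1` [set value (a ij.2 ij.1)].

Let bad_event (ij : 'I_n * 'I_m) : set T := X ij.1 ij.2 @^-1` (~` [set lo; hi]).

Let measurable_preimage i j (B : set R) : measurable B -> measurable (X i j @^-1` B).
Proof. by move=> mB; rewrite -[_ @^-1` _]setTI; exact: measurable_funP. Qed.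

Let measurable_pattern a : measurable (pattern_event a).
Proof.
apply: fin_bigcap_measurable; first exact: finite_finset.
by move=> ij _; apply: measurable_preimage; exact: measurable_set1.
Qed.

Let P_entry i j b : P (X i j @^-1` [set value b]) = (if b then p else 1 - p)%:E.
Proof.
have := iidX.2 i j _ (measurable_set1 (value b)).
rewrite /distribution /pushforward => ->.
rewrite !diracE /value; case: b.
  by rewrite memNset ?mem_set//= ?mule0 ?mule1 ?add0e// => /eqP; rewrite (negPf lohi).
by rewrite mem_set// memNset//= ?mule0 ?mule1 ?adde0// => /esym/eqP; rewrite (negPf lohi).
Qed.

Let P_pattern a : P (pattern_event a) = (\prod_l column_weight p (a l))%:E.
Proof.
rewrite (iidX.1 [set: _]%SET (fun ij => [set value (a ij.2 ij.1)])); last first.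
  by move=> ij; exact: measurable_set1.
rewrite (eq_bigr (fun ij => (if a ij.2 ij.1 then p else 1 - p)%:E)); last first.
  by move=> ij _; exact: P_entry.
rewrite prodEFin; congr EFin.
rewrite (eq_bigl xpredT) => [|ij]; last by rewrite finset.inE.
rewrite /column_weight exchange_big pair_bigA /=.
by apply: eq_bigr => -[i j].
Qed.

Let P_bad ij : P (bad_event ij) = 0%E.
Proof.
have m2 : measurable (~` [set lo; hi] : set R).
  by apply: measurableC; apply: measurableU; exact: measurable_set1.
have := iidX.2 ij.1 ij.2 _ m2; rewrite /distribution /pushforward => ->.
rewrite !diracE memNset; last by move=> h; apply: h; left.
by rewrite memNset ?mule0 ?adde0//= => h; apply: h; right.
Qed.

(** Carries bounds on finite weighted sums over to the abstract space. [E] is the union of the bad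
    patterns and of the null events where an entry takes neither value, so measurability of spectral
    quantities does not enter. *)
Lemma finite_model (Bad : pred {ffun 'I_m -> {ffun 'I_n -> bool}}) :
  exists E : set T, [/\ measurable E,
    (P E <= (\sum_(a | Bad a) \prod_l column_weight p (a l))%:E)%E &
    forall w, ~ E w -> exists a, ~~ Bad a /\
      forall i j, X i j w = if a j i then hi else lo].
Proof.
pose E1 := \big[setU/set0]_(a | Bad a) pattern_event a.
pose E2 := \big[setU/set0]_(ij : 'I_n * 'I_m) bad_event ij.
have mbad ij : measurable (bad_event ij).
  apply: measurable_preimage; apply: measurableC.
  by apply: measurableU; exact: measurable_set1.
have mE1 : measurable E1 by apply: bigsetU_measurable => a _.
have mE2 : measurable E2 by apply: bigsetU_measurable => ij _.
have subadd (I : Type) (r : seq I) (Q : pred I) (F : I -> set T) :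
    (forall i, measurable (F i)) ->
    (P (\big[setU/set0]_(i <- r | Q i) F i) <= \sum_(i <- r | Q i) P (F i))%E.
  move=> mF; elim: r => [|i r IH]; first by rewrite !big_nil measure0.
  rewrite !big_cons; case: (Q i) => //.
  apply: (le_trans (measureU2 _ _ _)) => //; first exact: bigsetU_measurable.
  by rewrite leeD2l.
exists (E1 `|` E2); split; first exact: measurableU.
  have h2 : (P E2 <= 0)%E.
    by apply: (le_trans (subadd _ _ _ _ mbad)); rewrite big1// => ij _; exact: P_bad.
  have h1 : (P E1 <= (\sum_(a | Bad a) \prod_l column_weight p (a l))%:E)%E.
    apply: (le_trans (subadd _ _ _ _ measurable_pattern)).
    by rewrite -sumEFin lee_sum// => a _; rewrite P_pattern.
  by rewrite -[leRHS]adde0; exact: (le_trans (measureU2 _ mE1 mE2) (leeD h1 h2)).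
move=> w nEw.
have val_w i j : X i j w = lo \/ X i j w = hi.
  apply: contrapT => h; apply: nEw; right.
  by rewrite /E2 -bigcup_seq; exists (i, j) => //=; rewrite mem_index_enum.
pose a : {ffun 'I_m -> {ffun 'I_n -> bool}} := [ffun j => [ffun i => X i j w == hi]].
have Xa i j : X i j w = if a j i then hi else lo.
  by rewrite !ffunE; case: eqP => // Xh; case: (val_w i j).
exists a; split => //; apply/negP => Ba; apply: nEw; left.
rewrite /E1 -bigcup_seq_cond; exists a; first by rewrite /= mem_index_enum.
by move=> [i j] _ /=; rewrite Xa.
Qed.

End finite_model.

Section almost_sure.
Context d (T : measurableType d) (R : realType) (P : probability T R).

Lemma sum_inv_consecutive N :
  \sum_(n < N) (n.+1%:R^-1 * n.+2%:R^-1) = 1 - N.+1%:R^-1 :> R.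
Proof.
elim: N => [|N IH]; first by rewrite big_ord0 invr1 subrr.
rewrite big_ord_recr /= IH.
rewrite -[N.+2%:R]natr1; have : 0 < N.+1%:R :> R by rewrite ltr0n.
move: (N.+1%:R : R) => y y0; field.
by apply/andP; split; apply: lt0r_neq0 => //; rewrite ltr_wpDr.
Qed.

(** Borel-Cantelli; the bounding series telescopes, so its sum is at most [K]. *)
Lemma ae_eventually_notin (E : nat -> set T) (K : R) : 0 <= K ->
  (forall n, measurable (E n)) ->
  (forall n, (P (E n) <= (K * (n.+1%:R^-1 * n.+2%:R^-1))%:E)%E) ->
  {ae P, forall w, exists N, forall n, (N <= n)%N -> ~ E n w}.
Proof.
move=> K0 mE PE.
have sumP : (\sum_(n <oo) P (E n) < +oo)%E.
  apply: (@le_lt_trans _ _ K%:E); last exact: ltry.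
  apply: lime_le; first by apply: is_cvg_nneseries => n _ _; exact: measure_ge0.
  apply: nearW => N; rewrite big_mkord.
  apply: (@le_trans _ _ (\sum_(n < N) (K * (n.+1%:R^-1 * n.+2%:R^-1))%:E)%E).
    by apply: lee_sum => n _; exact: PE.
  rewrite sumEFin lee_fin -mulr_sumr sum_inv_consecutive.
  by rewrite ler_piMr// gerBl invr_ge0.
have P0 := lim_sup_set_cvg0 mE sumP.
exists (lim_sup_set E); split => //.
  by apply: bigcap_measurable => // n _; apply: bigcup_measurable => k _; exact: mE.
move=> w /= nw n _; apply: contrapT => h; apply: nw; exists n => k nk Ekw.
by apply: h; exists k.
Qed.

Context (c alpha : R) (c0 : 0 < c) (alpha0 : 0 < alpha) (m : nat -> nat)
  (m_alpha : (m n)%:R / n%:R @[n --> \oo] --> alpha).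
Context (lo hi : nat -> R) (lohi : forall n, lo n != hi n)
  (X : forall n, 'I_n -> 'I_(m n) -> {RV P >-> R})
  (iidX : forall n, c <= n%:R -> iid_two_point_entries (c / n%:R) (lo n) (hi n) (@X n)).

Let G n j w := spectral_mean (scaled_gram c (sample_mx (@X n) w)) (decay j).

Context (close_model : forall n j w (a : {ffun 'I_(m n) -> {ffun 'I_n -> bool}}),
  (forall i k, X i k w = if a k i then hi n else lo n) ->
  `|G n j w - spectral_mean (scaled_gram c (bool_mx a)) (decay j)| <= n%:R^-1 * (2 * j%:R)).

(** The constant 6 is attained at [n = 1]. *)
Lemma inv_sqr_le n : (0 < n)%N -> n%:R^-1 ^+ 2 <= 6 * (n.+1%:R^-1 * n.+2%:R^-1) :> R.
Proof.
move=> n0; have nR : 1 <= n%:R :> R by rewrite ler1n.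
have n1 : 0 < n.+1%:R * n.+2%:R :> R by rewrite mulr_gt0.
rewrite -invfM exprVn ler_pdivlMr// mulrC ler_pdivrMr ?exprn_gt0 ?(lt_le_trans ltr01)//.
rewrite -!natr1; nra.
Qed.

(** [close_model] lets one argument serve both ensembles: the 0-1 matrices coincide with their
    model, and the centered ones differ from it by a constant shift. *)
Lemma ae_close_to_mean j (e : R) : 0 < e ->
  {ae P, forall w, \forall n \near \oo,
    `|G n j w - mean_functional c n (m n) (decay j)| <= e + n%:R^-1 * (2 * j%:R)}.
Proof.
move=> e0.
have [N0 hN0] : exists N0, forall n, (N0 <= n)%N ->
    [/\ (0 < n)%N, c <= n%:R & (m n)%:R / n%:R <= alpha + 1].
  have [N _ HN] : \forall n \near \oo,
      [/\ (0 < n)%N, c <= n%:R & (m n)%:R / n%:R <= alpha + 1].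
    near=> n; split; first by near: n; exists 1%N.
      by near: n; exact: nbhs_infty_ger.
    by near: n; apply: (cvgr_le _ m_alpha); rewrite ltrDl.
  by exists N.
pose Bad n (a : {ffun 'I_(m n) -> {ffun 'I_n -> bool}}) :=
  e < `|spectral_mean (scaled_gram c (bool_mx a)) (decay j) -
        mean_functional c n (m n) (decay j)|.
(* [24 = 4 * 6]: the 4 comes from the concentration bound, the 6 from [inv_sqr_le]; eventually
   [m n <= (alpha + 1) n]. *)
pose K : R := 24 * (alpha + 1) ^+ 2 * (2 * j%:R) ^+ 4 / e ^+ 4.
have K0 : 0 <= K by rewrite /K divr_ge0 ?exprn_ge0 ?(ltW e0)// !mulr_ge0 ?exprn_ge0 ?mulr_ge0// addr_ge0 ?ltW.
have /choice[E HE] : forall n, exists E : set T, [/\ measurable E,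
    (P E <= (K * (n.+1%:R^-1 * n.+2%:R^-1))%:E)%E &
    (N0 <= n)%N -> forall w, ~ E w -> exists a, ~~ Bad n a /\
      forall i k, X i k w = if a k i then hi n else lo n].
  move=> n; have [Nn|nN] := leqP N0 n; last first.
    exists set0; split => //.
      by rewrite measure0 lee_fin mulr_ge0// mulr_ge0 ?invr_ge0.
  have [n0 cn mn] := hN0 n Nn.
  have [E [mE PE EP]] := finite_model (lohi n) (iidX cn) (Bad n).
  exists E; split => //; apply: (le_trans PE); rewrite lee_fin.
  have conc := @spectral_mean_concentration R n (m n) c c0 j e n0 cn e0.
  apply: (le_trans conc).
  have nR : 0 < n%:R :> R by rewrite ltr0n.
  have mn' : (m n)%:R <= (alpha + 1) * n%:R by rewrite -ler_pdivrMr.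
  have mn2 : (m n)%:R ^+ 2 <= ((alpha + 1) * n%:R) ^+ 2.
    by rewrite lerXn2r// nnegrE// mulr_ge0// addr_ge0// ltW.
  have q0 : 0 <= 4 * (2 * j%:R) ^+ 4 / e ^+ 4 :> R.
    by rewrite divr_ge0 ?exprn_ge0 ?(ltW e0)// mulr_ge0 ?exprn_ge0 ?mulr_ge0.
  have -> : 4 * (m n)%:R ^+ 2 * (n%:R^-1 * (2 * j%:R)) ^+ 4 / e ^+ 4 =
     (4 * (2 * j%:R) ^+ 4 / e ^+ 4) * ((m n)%:R ^+ 2 * n%:R^-1 ^+ 4) :> R.
    by rewrite exprMn; ring.
  have -> : K * (n.+1%:R^-1 * n.+2%:R^-1) = (4 * (2 * j%:R) ^+ 4 / e ^+ 4) *
     ((alpha + 1) ^+ 2 * (6 * (n.+1%:R^-1 * n.+2%:R^-1))) by rewrite /K; ring.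
  rewrite ler_wpM2l//.
  apply: (@le_trans _ _ ((alpha + 1) ^+ 2 * n%:R^-1 ^+ 2)); last first.
    by rewrite ler_wpM2l ?sqr_ge0// inv_sqr_le.
  apply: (@le_trans _ _ (((alpha + 1) * n%:R) ^+ 2 * n%:R^-1 ^+ 4)).
    by rewrite ler_wpM2r ?exprn_ge0 ?invr_ge0.
  rewrite le_eqVlt; apply/orP; left; apply/eqP; field.
  by rewrite gt_eqF.
have := ae_eventually_notin K0 (fun n => let: And3 h _ _ := HE n in h)
  (fun n => let: And3 _ h _ := HE n in h).
apply: filterS => w [N HN]; near=> n.
have Nn : (N <= n)%N by near: n; exists N.
have N0n : (N0 <= n)%N by near: n; exists N0.
have [_ _ /(_ N0n w (HN n Nn))[a [nBad aX]]] := HE n.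
apply: le_trans (ler_distD (spectral_mean (scaled_gram c (bool_mx a)) (decay j)) _ _) _.
rewrite [leRHS]addrC; apply: lerD; first exact: (close_model _ aX).
by rewrite leNgt; exact: nBad.
Unshelve. all: by end_near. Qed.

(** The tolerances are restricted to [1 / (k + 1)], so that only countably many null sets are united
    over [j] and [k]. *)
Lemma ae_decay_cvg (l : nat -> R) :
  (forall j, mean_functional c n (m n) (decay j) @[n --> \oo] --> l j) ->
  {ae P, forall w, forall j, G n j w @[n --> \oo] --> l j}.
Proof.
move=> ml.
have H : {ae P, forall w, forall j, forall k, \forall n \near \oo,
    `|G n j w - mean_functional c n (m n) (decay j)| <= k.+1%:R^-1 + n%:R^-1 * (2 * j%:R)}.
  apply: ae_foralln => j; apply: ae_foralln => k; apply: ae_close_to_mean.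
  by rewrite invr_gt0.
move: H; apply: filterS => w Hw j; apply/cvgrPdist_le => e e0.
have e3 : 0 < e / 3 by rewrite divr_gt0.
have [k ke] : exists k : nat, k.+1%:R^-1 <= e / 3.
  exists (Num.bound (e / 3)^-1); rewrite -[leRHS]invrK lef_pV2 ?posrE ?invr_gt0//.
  have e3' : 0 <= (e / 3)^-1 by rewrite invr_ge0 ltW.
  by apply: ltW; apply: lt_trans (archi_boundP e3') _; rewrite ltr_nat.
have hk := Hw j k.
have /cvgrPdist_le/(_ _ e3) hm := ml j.
have hn : n%:R^-1 * (2 * j%:R) @[n --> \oo] --> (0 : R).
  by rewrite -(mul0r (2 * j%:R : R)); apply: cvgM; [exact: cvg_inv_nat|exact: cvg_cst].
have /cvgrPdist_le/(_ _ e3) hn' := hn.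
near=> n.
have h1 : `|G n j w - mean_functional c n (m n) (decay j)| <= k.+1%:R^-1 + n%:R^-1 * (2 * j%:R) by near: n.
have h2 : `|l j - mean_functional c n (m n) (decay j)| <= e / 3 by near: n.
have h3 : `|0 - n%:R^-1 * (2 * j%:R)| <= e / 3 by near: n.
have h4 := ler_norm (n%:R^-1 * (2 * j%:R) : R).
rewrite sub0r normrN in h3.
apply: le_trans (ler_distD (mean_functional c n (m n) (decay j)) _ _) _.
rewrite distrC in h1; apply: le_trans (lerD h2 h1) _.
apply: le_trans (lerD (lexx _) (lerD ke (le_trans h4 h3))) _; lra.
Unshelve. all: by end_near. Qed.

End almost_sure.

(** * Weak convergence *)

Section spectral_integral.
Context {R : realType} {n : nat} (W : 'M[R]_n).

Let ge0_spectral_integral (g : R -> R) : (forall x, 0 <= g x) -> continuous g ->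
  (\int[spectral_measure W]_x (g x)%:E = (spectral_mean W g)%:E)%E.
Proof.
move=> g0 cg.
have mg : measurable_fun [set: R] (EFin \o g).
  by apply/measurable_EFinP; exact: continuous_measurable_fun.
rewrite /spectral_measure ge0_integral_mscale//; last by move=> x _; rewrite lee_fin.
rewrite ge0_integral_measure_sum//; last by move=> x _; rewrite lee_fin.
rewrite /spectral_mean EFinM; congr (_ * _)%E.
rewrite (big_nth 0) big_mkord -sumEFin; apply: eq_bigr => i _.
by rewrite integral_dirac// diracT mul1e.
Qed.

Lemma spectral_integral (f : R -> R) : continuous f ->
  (\int[spectral_measure W]_x (f x)%:E = (spectral_mean W f)%:E)%E.
Proof.
move=> cf; rewrite integralE.
pose fp x := (`|f x| + f x) / 2; pose fn x := (`|f x| - f x) / 2.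
have cnf : continuous (fun x => `|f x|).
  by move=> x; apply: (cvg_comp f (fun t => `|t|)); [exact: cf|exact: norm_continuous].
have -> : (\int[spectral_measure W]_x ((EFin \o f)^\+ x) =
    \int[spectral_measure W]_x (fp x)%:E)%E.
  apply: eq_integral => x _; rewrite funeposE /= -EFin_max; congr EFin.
  by rewrite /fp; have [fx|fx] := leP (f x) 0; [rewrite ler0_norm|rewrite gtr0_norm]; lra.
have -> : (\int[spectral_measure W]_x ((EFin \o f)^\- x) =
    \int[spectral_measure W]_x (fn x)%:E)%E.
  apply: eq_integral => x _; rewrite funenegE /= -EFin_max; congr EFin.
  by rewrite /fn; have [fx|fx] := leP (- f x) 0; [rewrite ger0_norm|rewrite ltr0_norm]; lra.
rewrite !ge0_spectral_integral.
- rewrite -EFinB; congr EFin; rewrite /spectral_mean -mulrBr -sumrB; congr (_ * _).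
  by apply: eq_bigr => x _; rewrite /fp /fn; field.
- by move=> x; rewrite /fn divr_ge0// subr_ge0 ler_norm.
- by move=> x; apply: cvgM; [apply: cvgB; [exact: cnf|exact: cf]|exact: cvg_cst].
- by move=> x; rewrite /fp divr_ge0//; have := ler_norm (- f x); rewrite normrN; lra.
- by move=> x; apply: cvgM; [apply: cvgD; [exact: cnf|exact: cf]|exact: cvg_cst].
Qed.

End spectral_integral.

Section decay_functions.
Context {R : realType}.
Implicit Types (x : R) (f g : R -> R).

(* [max x 0] *)
Definition pos x : R := (x + `|x|) / 2.

Lemma pos_ge0 x : 0 <= pos x.
Proof. by rewrite /pos divr_ge0//; have := ler_norm (- x); rewrite normrN; lra. Qed.

Lemma pos_id x : 0 <= x -> pos x = x.
Proof. by move=> x0; rewrite /pos ger0_norm//; lra. Qed.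

Lemma pos_le0 x : x <= 0 -> pos x = 0.
Proof. by move=> x0; rewrite /pos ler0_norm//; lra. Qed.

Lemma le_pos x y : x <= y -> pos x <= pos y.
Proof.
move=> xy; have [x0|x0] := leP x 0; first by rewrite (pos_le0 x0) pos_ge0.
by rewrite !pos_id// ?ltW// (lt_le_trans x0).
Qed.

Lemma continuous_pos : continuous pos.
Proof.
move=> x; apply: cvgM; last exact: cvg_cst.
by apply: cvgD; [exact: cvg_id|exact: norm_continuous].
Qed.

Lemma onepos_gt0 x : 0 < 1 + pos x.
Proof. by rewrite ltr_wpDr// pos_ge0. Qed.

Lemma decayE j x : decay j x = (1 + pos x)^-1 ^+ j. Proof. by []. Qed.

Lemma decay1_itv x : 0 < decay 1 x <= 1.
Proof.
rewrite decayE expr1 invr_gt0 onepos_gt0/= invf_le1 ?onepos_gt0//.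
by rewrite lerDl pos_ge0.
Qed.

Lemma decay_decay1 j x : decay j x = decay 1 x ^+ j.
Proof. by rewrite !decayE expr1. Qed.

Lemma continuous_decay1 : continuous (decay 1 : R -> R).
Proof.
move=> x; rewrite (_ : decay 1 = fun x => (1 + pos x)^-1); last first.
  by apply/funext => z; rewrite decayE expr1.
apply: cvgV; first by rewrite gt_eqF// onepos_gt0.
by apply: cvgD; [exact: cvg_cst|exact: continuous_pos].
Qed.

Lemma bounded_continuous_decay j : bounded_continuous (decay j : R -> R).
Proof.
elim: j => [|j IH].
  rewrite (_ : decay 0 = fun=> 1); first exact: bounded_continuous_cst.
  by apply/funext => x; rewrite decayE expr0.
rewrite (_ : decay j.+1 = fun x => decay 1 x * decay j x); last first.
  by apply/funext => x; rewrite !decayE expr1 exprS.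
apply: bounded_continuousM => //; split; first exact: continuous_decay1.
exists 1 => x; have /andP[d0 d1] := decay1_itv x.
by rewrite ger0_norm// ltW.
Qed.

Lemma decay_ge0 j x : 0 <= decay j x.
Proof. by rewrite decayE exprn_ge0// invr_ge0 ltW// onepos_gt0. Qed.

Lemma decay_noninc j x y : x <= y -> decay j y <= decay j x.
Proof.
move=> xy; rewrite !decayE lerXn2r// ?nnegrE ?invr_ge0 ?(ltW (onepos_gt0 _))//.
by rewrite lef_pV2 ?posrE ?onepos_gt0// lerD2l le_pos.
Qed.

Lemma decay_le0 j x : x <= 0 -> decay j x = 1.
Proof. by move=> x0; rewrite decayE pos_le0// addr0 invr1 expr1n. Qed.

Lemma decay_small j (e : R) : 0 < e -> exists x, decay j.+1 x < e.
Proof.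
move=> e0; exists e^-1; have ei0 : 0 < e^-1 by rewrite invr_gt0.
have /andP[d0 d1] := decay1_itv e^-1.
apply: (@le_lt_trans _ _ (decay 1 e^-1)).
  by rewrite decay_decay1 exprS ler_piMr ?(ltW d0)// exprn_ile1// ltW.
rewrite decayE expr1 pos_id; last exact: ltW.
by rewrite -[ltRHS]invrK ltf_pV2 ?posrE ?addr_gt0// ltrDr.
Qed.

End decay_functions.

(** * From powers of the decay function to all bounded continuous functions *)

Section weak_convergence.
Context {R : realType} (mu : probability R R) (C : R)
  (mu_neg : forall x, x < 0 -> mu `]-oo, x]%classic = 0%E)
  (mu_tail : forall t, 0 < t -> ((1 - C / t)%:E <= mu `]-oo, t]%classic)%E)
  (Lam : nat -> (R -> R) -> R) (pfL : forall n, positive_functional (Lam n))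
  (cvg_decay : forall j, Lam n (decay j) @[n --> \oo] --> \int[mu]_x decay j x).
Implicit Types f g : R -> R.

Definition converges f := Lam n f @[n --> \oo] --> \int[mu]_x f x.

Let intble f := @bounded_continuous_integrable R mu f.

Lemma convergesD f g : bounded_continuous f -> bounded_continuous g ->
  converges f -> converges g -> converges (fun x => f x + g x).
Proof.
move=> bf bg cf cg; rewrite /converges RintegralD//; [|exact: intble|exact: intble].
rewrite (_ : (fun n => _) = fun n => Lam n f + Lam n g); first exact: cvgD.
by apply/funext => n; rewrite (pfD (pfL n)).
Qed.

Lemma convergesZ k f : bounded_continuous f -> converges f -> converges (fun x => k * f x).
Proof.
move=> bf cf; rewrite /converges RintegralZl//; last exact: intble.
rewrite (_ : (fun n => _) = fun n => k * Lam n f); last first.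
  by apply/funext => n; rewrite (pfZ (pfL n)).
by apply: cvgM => //; exact: cvg_cst.
Qed.

Lemma converges_cst k : converges (fun=> k).
Proof.
rewrite (_ : (fun=> k) = fun x => k * decay 0 x); last first.
  by apply/funext => x; rewrite decayE expr0 mulr1.
by apply: convergesZ; [exact: bounded_continuous_decay|exact: cvg_decay].
Qed.

Lemma converges_poly (p : {poly R}) : bounded_continuous (fun x => p.[decay 1 x]) /\
  converges (fun x => p.[decay 1 x]).
Proof.
rewrite (_ : (fun x => _) = fun x => \sum_(i < size p) p`_i * decay i x); last first.
  apply/funext => x; rewrite horner_coef; apply: eq_bigr => i _.
  by rewrite -decay_decay1.
elim: (size p) => [|N [IHb IHc]].
  rewrite (_ : (fun x => _) = fun=> 0); last by apply/funext => x; rewrite big_ord0.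
  by split; [exact: bounded_continuous_cst|exact: converges_cst].
rewrite (_ : (fun x => _) = fun x => (\sum_(i < N) p`_i * decay i x) + p`_N * decay N x).
  have bN : bounded_continuous (fun x => p`_N * decay N x).
    by apply: bounded_continuousZ; exact: bounded_continuous_decay.
  split; first exact: bounded_continuousD.
  apply: convergesD => //; apply: convergesZ; [exact: bounded_continuous_decay|exact: cvg_decay].
by apply/funext => x; rewrite big_ord_recr.
Qed.

(** The error bound [r] must itself converge, so that its small integral under [mu] also controls
    [Lam n r] for large [n]. *)
Lemma converges_close f : bounded_continuous f -> (forall e : R, 0 < e -> exists g r,
    [/\ bounded_continuous g, converges g, bounded_continuous r, converges r &
     (forall x, `|f x - g x| <= r x) /\ \int[mu]_x r x <= e]) -> converges f.
Proof.
move=> bf H; apply/cvgrPdist_le => e e0.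
have e4 : 0 < e / 4 by rewrite divr_gt0.
have [g [r [bg cg br cr [fgr re]]]] := H _ e4.
have /cvgrPdist_le/(_ _ e4) hg := cg.
have /cvgrPdist_le/(_ _ e4) hr := cr.
have I1 : \int[mu]_x f x <= \int[mu]_x g x + \int[mu]_x r x.
  rewrite -RintegralD//; [|exact: intble|exact: intble].
  apply: le_Rintegral => //; [exact: intble|by apply: intble; exact: bounded_continuousD|].
  by move=> x _; have := fgr x; rewrite ler_norml => /andP[]; lra.
have I2 : \int[mu]_x g x <= \int[mu]_x f x + \int[mu]_x r x.
  rewrite -RintegralD//; [|exact: intble|exact: intble].
  apply: le_Rintegral => //; [exact: intble|by apply: intble; exact: bounded_continuousD|].
  by move=> x _; have := fgr x; rewrite ler_norml => /andP[]; lra.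
near=> n.
have L1 : Lam n f <= Lam n g + Lam n r.
  rewrite -(pfD (pfL n)); apply: (pf_le (pfL n)) => x _.
  by have := fgr x; rewrite ler_norml => /andP[]; lra.
have L2 : Lam n g <= Lam n f + Lam n r.
  rewrite -(pfD (pfL n)); apply: (pf_le (pfL n)) => x _.
  by have := fgr x; rewrite ler_norml => /andP[]; lra.
have h1 : `|\int[mu]_x g x - Lam n g| <= e / 4 by near: n.
have h2 : `|\int[mu]_x r x - Lam n r| <= e / 4 by near: n.
move: h1 h2; rewrite !ler_norml => /andP[h1 h2] /andP[h3 h4].
by apply/andP; split; lra.
Unshelve. all: by end_near. Qed.

Lemma converges_comp_decay (h : R -> R) : continuous h -> converges (fun x => h (decay 1 x)).
Proof.
move=> ch.
have ch1 : {within `[0, 1], continuous h} by apply: continuous_subspaceT.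
have bh : bounded_continuous (fun x => h (decay 1 x)).
  split.
    by move=> x; apply: (cvg_comp (decay 1) h); [exact: continuous_decay1|exact: ch].
  have [p hp] := weierstrass01 ch1 ltr01.
  have [[_ [B pB]] _] := converges_poly p.
  exists (1 + B) => x; have /andP[d0 d1] := decay1_itv x.
  have h1 := hp (decay 1 x); rewrite (ltW d0) d1 in h1.
  rewrite -[h _](subrK p.[decay 1 x]).
  by apply: le_trans (ler_normD _ _) _; apply: lerD; [exact: h1|exact: pB].
apply: converges_close => // e e0.
have [p hp] := weierstrass01 ch1 e0.
have [bp cp] := converges_poly p.
exists (fun x => p.[decay 1 x]), (fun=> e); split => //.
- exact: bounded_continuous_cst.
- exact: converges_cst.
split.
  by move=> x; have /andP[d0 d1] := decay1_itv x; apply: hp; rewrite (ltW d0) d1.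
by rewrite Rintegral_cst// (congr1 fine (probability_setT mu)) mulr1.
Qed.

Definition cutoff (K x : R) : R := clamp (K + 1 - pos x).

Lemma cutoff_itv K x : 0 <= cutoff K x <= 1.
Proof. by rewrite /cutoff clamp_ge0 clamp_le1. Qed.

Lemma bounded_continuous_cutoff K : bounded_continuous (cutoff K).
Proof.
apply: bounded_continuous_clamp => x.
by apply: cvgB; [exact: cvg_cst|exact: continuous_pos].
Qed.

Lemma converges_cutoff K f : 0 < K -> bounded_continuous f ->
  converges (fun x => f (pos x) * cutoff K x).
Proof.
(* The cutoff vanishes once [pos x >= K + 1], that is, once [decay 1 x <= 1 / (K + 2)]. Replacing
   [y] by [mx y], the maximum of [y] and [eta], thus changes nothing in the product and makes
   [1 / y - 1], the inverse of [decay 1], continuous on the whole line. *)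
move=> K0 bf; pose eta : R := (K + 2)^-1.
have eta0 : 0 < eta by rewrite invr_gt0 addr_gt0.
pose mx (y : R) := eta + pos (y - eta).
have mx0 y : 0 < mx y by rewrite ltr_wpDr ?pos_ge0.
pose h y := f ((mx y)^-1 - 1) * clamp (K + 1 - ((mx y)^-1 - 1)).
have cmx : continuous (fun y => (mx y)^-1 - 1).
  move=> y; apply: cvgB; last exact: cvg_cst.
  apply: cvgV; first by rewrite gt_eqF.
  apply: cvgD; first exact: cvg_cst.
  apply: (cvg_comp (fun y => y - eta) pos); last exact: continuous_pos.
  by apply: cvgB; [exact: cvg_id|exact: cvg_cst].
have ch : continuous h.
  move=> y; apply: cvgM.
    by apply: (cvg_comp (fun y => (mx y)^-1 - 1) f); [exact: cmx|exact: bf.1].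
  apply: (cvg_comp (fun y => K + 1 - ((mx y)^-1 - 1)) clamp); last exact: continuous_clamp.
  by apply: cvgB; [exact: cvg_cst|exact: cmx].
rewrite (_ : (fun x => _) = fun x => h (decay 1 x)); first exact: converges_comp_decay.
apply/funext => x; rewrite /h /cutoff.
have p0 := pos_ge0 x.
have [xK|xK] := leP (pos x) (K + 1).
  have -> : mx (decay 1 x) = decay 1 x.
    rewrite /mx pos_id; first by rewrite addrC subrK.
    rewrite subr_ge0 decayE expr1 lef_pV2 ?posrE ?onepos_gt0 ?addr_gt0//; lra.
  have -> : (decay 1 x)^-1 - 1 = pos x by rewrite decayE expr1 invrK addrC addKr.
  by [].
have -> : mx (decay 1 x) = eta.
  rewrite /mx pos_le0 ?addr0// subr_le0 decayE expr1.
  by rewrite lef_pV2 ?posrE ?onepos_gt0 ?addr_gt0//; lra.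
rewrite clamp_eq0; last by lra.
rewrite clamp_eq0; last by rewrite invrK; lra.
by rewrite !mulr0.
Qed.

Lemma Rintegral_cutoff_ge K : 0 < K -> 1 - C / K <= \int[mu]_x cutoff K x.
Proof.
move=> K0; apply: (@le_trans _ _ (\int[mu]_x (\1_(`]-oo, K]%classic) x))).
  rewrite /Rintegral integral_indic// setIT -lee_fin fineK; first exact: mu_tail.
  exact: fin_num_measure.
apply: le_Rintegral => //.
- exact: integrable_indic_below.
- by apply: intble; exact: bounded_continuous_cutoff.
move=> x _; rewrite indicE; case: (boolP (x \in _)) => [|_]; last exact: clamp_ge0.
rewrite inE/= in_itv/= => xK; rewrite /cutoff clamp_eq1//.
have := le_pos xK; rewrite (pos_id (ltW K0)); lra.
Qed.

Lemma converges_pos f : bounded_continuous f -> converges (fun x => f (pos x)).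
Proof.
move=> bf; have [cf [B fB]] := bf.
have B0 : 0 <= B by exact: le_trans (normr_ge0 (f 0)) (fB 0).
have bfp : bounded_continuous (fun x => f (pos x)).
  split; last by exists B.
  by move=> x; apply: (cvg_comp pos f); [exact: continuous_pos|exact: cf].
apply: converges_close => // e e0.
(* The loss outside the cutoff is at most [B |C| / K <= e]. *)
pose K : R := B * `|C| / e + 1.
have K0 : 0 < K by rewrite /K ltr_wpDl// divr_ge0 ?mulr_ge0// ltW.
have bchi := bounded_continuous_cutoff K.
have b1 := @bounded_continuous_cst R 1.
have cchi : converges (cutoff K).
  rewrite (_ : cutoff K = fun x => (fun=> 1) (pos x) * cutoff K x); first exact: (converges_cutoff K0 b1).
  by apply/funext => x; rewrite mul1r.
have bm : bounded_continuous (fun x => -1 * cutoff K x) by exact: bounded_continuousZ.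
exists (fun x => f (pos x) * cutoff K x), (fun x => B * (1 + -1 * cutoff K x)); split.
- exact: bounded_continuousM.
- exact: converges_cutoff.
- by apply: bounded_continuousZ; exact: bounded_continuousD.
- apply: convergesZ; first exact: bounded_continuousD.
  apply: convergesD => //; first exact: converges_cst.
  exact: convergesZ.
split.
  move=> x; have /andP[k0 k1] := cutoff_itv K x.
  rewrite -{1}[f (pos x)]mulr1 -mulrBr normrM [X in _ * X]ger0_norm ?subr_ge0//.
  by rewrite mulN1r ler_wpM2r ?subr_ge0.
rewrite RintegralZl//; last by apply: intble; exact: bounded_continuousD.
rewrite RintegralD//; [|exact: intble|exact: intble].
rewrite RintegralZl//; last exact: intble.
rewrite Rintegral_cst// (congr1 fine (probability_setT mu)) mulr1 mulN1r.
have hK := Rintegral_cutoff_ge K0.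
apply: (@le_trans _ _ (B * (`|C| / K))).
  rewrite ler_wpM2l//; have : C / K <= `|C| / K by rewrite ler_wpM2r ?ler_norm ?invr_ge0 ?ltW.
  lra.
rewrite mulrA ler_pdivrMr// /K mulrDr mulr1 (mulrC e) divfK ?gt_eqF//.
by rewrite lerDl ltW.
Qed.

(** The negative half-line is a countable union of the null sets []-oo, - 1 / (k + 1)]]. *)
Lemma Rintegral_pos f : bounded_continuous f -> \int[mu]_x f (pos x) = \int[mu]_x f x.
Proof.
move=> bf; congr fine; apply: ae_eq_integral => //.
- by apply/measurable_EFinP; apply: continuous_measurable_fun => x;
    apply: (cvg_comp pos f); [exact: continuous_pos|exact: bf.1].
- by apply/measurable_EFinP; apply: continuous_measurable_fun; exact: bf.1.
have H : {ae mu, forall x, forall k : nat, ~ (x <= - k.+1%:R^-1)}.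
  apply: ae_foralln => k; exists `]-oo, - k.+1%:R^-1]%classic; split => //.
    by apply: mu_neg; rewrite oppr_lt0 invr_gt0.
  by move=> x /= /contrapT xk; rewrite in_itv.
move: H; apply: filterS => x xk _; rewrite pos_id// leNgt; apply/negP => x0.
have x1 : 0 <= (- x)^-1 by rewrite invr_ge0 oppr_ge0 ltW.
apply: (xk (Num.bound (- x)^-1)); rewrite lerNr.
rewrite -[leRHS]invrK lef_pV2 ?posrE ?invr_gt0 ?oppr_gt0//.
by apply: ltW; apply: lt_trans (archi_boundP x1) _; rewrite ltr_nat.
Qed.

Lemma converges_bounded_continuous f : bounded_continuous f -> converges f.
Proof.
move=> bf; have := converges_pos bf; rewrite /converges Rintegral_pos//.
rewrite (_ : (fun n => Lam n (fun x => f (pos x))) = fun n => Lam n f)//.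
by apply/funext => n; apply/eqP; rewrite eq_le; apply/andP; split;
  apply: (pf_le (pfL n)) => x x0; rewrite pos_id.
Qed.

End weak_convergence.

(** Supplies reference dimensions built from [alpha] alone, so that the limit law can be fixed
    before [m] is given. *)
Lemma cvg_truncn {R : realType} (alpha : R) : 0 < alpha ->
  (Num.truncn (alpha * n%:R))%:R / n%:R @[n --> \oo] --> alpha.
Proof.
move=> a0; apply: (@squeeze_cvgr _ _ _ _ (fun n => alpha - n%:R^-1) (fun=> alpha)).
- near=> n; have n0 : 0 < n%:R :> R by rewrite ltr0n; near: n; exists 1%N.
  have an0 : 0 <= alpha * n%:R by rewrite mulr_ge0// ltW.
  have /andP[h1 h2] := truncn_itv an0; apply/andP; split; last by rewrite ler_pdivrMr.
  rewrite ler_pdivlMr// mulrBl mulVf ?gt_eqF//.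
  by move: h2; rewrite -natr1; lra.
- rewrite -[X in _ --> X](subr0 alpha).
  by apply: cvgB; [exact: cvg_cst|exact: cvg_inv_nat].
- exact: cvg_cst.
Unshelve. all: by end_near. Qed.

Lemma weak_cvg_spectral {R : realType} (c : R) (mu : probability R R) (C : R)
    (m : nat -> nat) (A : forall n, 'M[R]_(n, m n)) : 0 < c ->
  (forall x, x < 0 -> mu `]-oo, x]%classic = 0%E) ->
  (forall t, 0 < t -> ((1 - C / t)%:E <= mu `]-oo, t]%classic)%E) ->
  (forall j, spectral_mean (scaled_gram c (A n)) (decay j) @[n --> \oo]
     --> \int[mu]_x decay j x) ->
  weak_cvg (fun n => spectral_measure (scaled_gram c (A n))) mu.
Proof.
move=> c0 mu_neg mu_tail cvg_decay f cf [B [_ fB]].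
have bf : bounded_continuous f.
  by split => //; exists (B + 1) => x; apply: (fB (B + 1)) => //; rewrite ltrDl.
have h := converges_bounded_continuous mu_neg mu_tail
  (fun n => spectral_mean_pf c0 (A n)) cvg_decay bf.
rewrite (_ : (fun n => _) = fun n => (spectral_mean (scaled_gram c (A n)) f)%:E); last first.
  by apply/funext => n; rewrite spectral_integral.
rewrite (_ : (\int[mu]_x (f x)%:E)%E = (\int[mu]_x f x)%:E).
  by apply/cvg_EFin; [exact: nearW|exact: h].
rewrite /Rintegral fineK//; apply: integrable_fin_num => //.
exact: bounded_continuous_integrable.
Qed.

Theorem theorem2 (R : realType) (alpha c : R) (alpha_gt0 : 0 < alpha)
    (c_gt0 : 0 < c) :
  exists mu : probability R R,
    forall m : nat -> nat,
      (forall n, (0 < n)%N -> (0 < m n)%N) ->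
      (m n)%:R / n%:R @[n --> \oo] --> alpha ->
    forall (d : measure_display) (T : measurableType d) (P : probability T R),
      (forall A : forall n, 'I_n -> 'I_(m n) -> {RV P >-> R},
         (forall n, c <= n%:R ->
            iid_two_point_entries (c / n%:R) 0 1 (A n)) ->
         {ae P, forall w,
            weak_cvg
              (fun n => spectral_measure (scaled_gram c (sample_mx (A n) w)))
              mu})
      /\
      (forall X : forall n, 'I_n -> 'I_(m n) -> {RV P >-> R},
         (forall n, c <= n%:R ->
            iid_two_point_entries (c / n%:R) (- (c / n%:R)) (1 - c / n%:R)
              (X n)) ->
         {ae P, forall w,
            weak_cvg
              (fun n => spectral_measure (scaled_gram c (sample_mx (X n) w)))
              mu}).
Proof.
have [C C0 growth] := limit_moment_growth alpha_gt0 c_gt0.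
have mL0 := mean_functional_moments c_gt0 alpha_gt0 (cvg_truncn alpha_gt0).
have [mu [mu_neg mu_tail mu_f]] := limit_measure_exists (erefl _) C0 growth mL0.
exists mu => m _ m_alpha d T P.
have mL := mean_functional_moments c_gt0 alpha_gt0 m_alpha.
have decay_lim j :
    mean_functional c n (m n) (decay j) @[n --> \oo] --> \int[mu]_x decay j x.
  (* [decay 0] is the constant 1, which does not tend to 0 as the layer argument requires; its limit
     is the moment of order 0. *)
  case: j => [|j].
    have -> : decay 0 = (fun x : R => x ^+ 0) by apply/funext => x; rewrite decayE !expr0.
    under eq_Rintegral do rewrite expr0.
    rewrite Rintegral_cst// (congr1 fine (probability_setT mu)) mulr1.
    exact: (mL.2 0%N).
  have [cd [B dB]] := @bounded_continuous_decay R j.+1.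
  (* The reference dimensions and the given [m] have the same limit moments, hence the same limits
     on bounded continuous functions. *)
  apply: (moment_convergent_same_lim mL0 mL).
    exact: (moment_approx_bounded_continuous C0 growth cd dB).
  apply: mu_f; [exact: bounded_continuous_decay|exact: decay_noninc|exact: decay_le0|
    exact: decay_ge0|exact: decay_small].
split => [A iidA|X iidX].
- have lohi (n : nat) : (0 : R) != 1 by rewrite eq_sym oner_neq0.
  have := @ae_decay_cvg _ _ R P c alpha c_gt0 alpha_gt0 m m_alpha (fun=> 0) (fun=> 1) lohi A
    iidA _ _ decay_lim.
  move=> H; have {}H := H _; apply: filterS (H _) => [w Hw|n j w a Xa].
    exact: (weak_cvg_spectral c_gt0 mu_neg mu_tail Hw).
  rewrite (_ : sample_mx (A n) w = bool_mx a).
    by rewrite subrr normr0 mulr_ge0 ?invr_ge0// mulr_ge0.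
  by apply/matrixP => i k; rewrite !mxE Xa; case: (a k i).
have lohi (n : nat) : - (c / n%:R) != 1 - c / n%:R.
  by apply/negP => /eqP h; lra.
have H := @ae_decay_cvg _ _ R P c alpha c_gt0 alpha_gt0 m m_alpha _ _ lohi X
    iidX _ _ decay_lim.
apply: filterS (H _) => [w Hw|n j w a Xa].
  exact: (weak_cvg_spectral c_gt0 mu_neg mu_tail Hw).
rewrite (_ : sample_mx (X n) w = bool_mx a - const_mx (c / n%:R)).
  exact: spectral_mean_decay_shift.
by apply/matrixP => i k; rewrite !mxE Xa; case: (a k i); rewrite ?sub0r.
Qed.
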